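(* Let $\rho:\mathbb{Z}^p\times\mathbb{R}^q\to\mathrm{Diff}[[\mathbb{C}^n,0]]$ be a homomorphism of Lie groups. Then there exists an abelian linear algebraic group $G$ over $\mathbb{C}$ (in particular an abelian Lie group with finitely many connected components) and a homomorphism of Lie groups $\rho^*:G\to\mathrm{Diff}[[\mathbb{C}^n,0]]$ such that $\operatorname{Im}\rho\subset\operatorname{Im}\rho^*$.
   Context: $\mathrm{Diff}[[\mathbb{C}^n,0]]$ is the group of $\mathbb{C}$-algebra automorphisms of $\mathbb{C}[[x_1,\dots,x_n]]$ preserving the maximal ideal $\mathfrak m$. A map from a Lie group into $\mathrm{Diff}[[\mathbb{C}^n,0]]$ is called a homomorphism of Lie groups if for every $p$ the induced map into the finite-dimensional group of automorphisms of $\mathbb{C}[[x]]/\mathfrak m^{p+1}$ is a homomorphism of Lie groups. *)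

(* Defs.v *)
From Stdlib Require Import Reals ZArith.
From Stdlib Require Vectors.Fin.
Open Scope R_scope.

Definition C : Type := (R * R)%type.
Definition C0 : C := (0, 0).
Definition C1 : C := (1, 0).
Definition Cadd (z w : C) : C := (fst z + fst w, snd z + snd w).
Definition Copp (z : C) : C := (- fst z, - snd z).
Definition Csub (z w : C) : C := Cadd z (Copp w).
Definition Cmul (z w : C) : C :=
  (fst z * fst w - snd z * snd w, fst z * snd w + snd z * fst w).
Definition Cnorm (z : C) : R := sqrt (fst z * fst z + snd z * snd z).
Fixpoint Cpow (z : C) (k : nat) : C :=
  match k with O => C1 | S k' => Cmul z (Cpow z k') end.

Fixpoint fsum (N : nat) : (Fin.t N -> C) -> C :=
  match N return (Fin.t N -> C) -> C with
  | O => fun _ => C0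
  | S m => fun f => Cadd (f Fin.F1) (fsum m (fun i => f (Fin.FS i)))
  end.
Fixpoint fprod (N : nat) : (Fin.t N -> C) -> C :=
  match N return (Fin.t N -> C) -> C with
  | O => fun _ => C1
  | S m => fun f => Cmul (f Fin.F1) (fprod m (fun i => f (Fin.FS i)))
  end.

Definition midx (n : nat) : Type := Fin.t n -> nat.
Definition midx0 (n : nat) : midx n := fun _ => O.
Definition fcons {m : nat} (j : nat) (b : midx m) : midx (S m) :=
  fun i => Fin.caseS' i (fun _ => nat) j b.
Fixpoint natsum (k : nat) (g : nat -> C) : C :=
  match k with O => g O | S k' => Cadd (natsum k' g) (g k) end.
Fixpoint boxsum (n : nat) : midx n -> (midx n -> C) -> C :=
  match n return midx n -> (midx n -> C) -> C with
  | O => fun _ f => f (fun i => Fin.case0 (fun _ => nat) i)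
  | S m => fun a f =>
      natsum (a Fin.F1)
        (fun j => boxsum m (fun i => a (Fin.FS i)) (fun b => f (fcons j b)))
  end.
Fixpoint midx_eqb (n : nat) : midx n -> midx n -> bool :=
  match n return midx n -> midx n -> bool with
  | O => fun _ _ => true
  | S m => fun a b =>
      andb (Nat.eqb (a Fin.F1) (b Fin.F1))
           (midx_eqb m (fun i => a (Fin.FS i)) (fun i => b (Fin.FS i)))
  end.

Definition series (n : nat) : Type := midx n -> C.
Definition sadd {n} (f g : series n) : series n := fun a => Cadd (f a) (g a).
Definition sscal {n} (c : C) (f : series n) : series n := fun a => Cmul c (f a).
Definition smul {n} (f g : series n) : series n :=
  fun a => boxsum n a (fun b => Cmul (f b) (g (fun i => (a i - b i)%nat))).
Definition mono {n} (b : midx n) : series n :=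
  fun a => if midx_eqb n a b then C1 else C0.
Definition sone {n} : series n := mono (midx0 n).

(** * Diff[[C^n,0]]: C-algebra automorphisms of C[[x]] preserving m *)
Definition IsAut {n} (Phi : series n -> series n) : Prop :=
  (forall f g, Phi (sadd f g) = sadd (Phi f) (Phi g)) /\
  (forall c f, Phi (sscal c f) = sscal c (Phi f)) /\
  (forall f g, Phi (smul f g) = smul (Phi f) (Phi g)) /\
  Phi sone = sone /\
  (exists Psi : series n -> series n,
      (forall f, Psi (Phi f) = f) /\ (forall f, Phi (Psi f) = f)) /\
  (forall f, f (midx0 n) = C0 <-> Phi f (midx0 n) = C0).

(* Matrix coefficient of the induced linear map on C[[x]]/m^(k+1):
   coefficient of x^a in Phi(x^b); these (for |a|,|b| <= k) are the
   coordinates of the truncation of Phi to the finite-dim jet group. *)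
Definition jcoef {n} (Phi : series n -> series n) (a b : midx n) : C :=
  Phi (mono b) a.

Definition zadd {p} (k k' : Fin.t p -> Z) : Fin.t p -> Z := fun i => (k i + k' i)%Z.
Definition radd {q} (t t' : Fin.t q -> R) : Fin.t q -> R := fun i => t i + t' i.

Definition IsLieHomZR (n p q : nat)
  (rho : (Fin.t p -> Z) -> (Fin.t q -> R) -> series n -> series n) : Prop :=
  (forall k t, IsAut (rho k t)) /\
  (forall k k' t t' f, rho (zadd k k') (radd t t') f = rho k t (rho k' t' f)) /\
  (forall (a b : midx n) k t eps, eps > 0 ->
     exists delta, delta > 0 /\
       forall t', (forall i, Rabs (t' i - t i) < delta) ->
         Cnorm (Csub (jcoef (rho k t') a b) (jcoef (rho k t) a b)) < eps).

Definition mat (N : nat) : Type := Fin.t N -> Fin.t N -> C.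
Definition mmul {N} (A B : mat N) : mat N :=
  fun i j => fsum N (fun l => Cmul (A i l) (B l j)).
Definition mid {N} : mat N :=
  fun i j => if Fin.eq_dec i j then C1 else C0.
Definition invertible {N} (A : mat N) : Prop :=
  exists B : mat N, mmul A B = mid /\ mmul B A = mid.
Definition mpoly (N : nat) : Type := list (C * (Fin.t N -> Fin.t N -> nat)).
Definition meval {N} (P : mpoly N) (A : mat N) : C :=
  List.fold_right
    (fun m acc => Cadd (Cmul (fst m)
        (fprod N (fun i => fprod N (fun j => Cpow (A i j) (snd m i j))))) acc)
    C0 P.

Definition AbelianLinAlgGroup (N : nat) (G : mat N -> Prop) : Prop :=
  (exists S : mpoly N -> Prop,
     forall A, G A <-> (invertible A /\ forall P, S P -> meval P A = C0)) /\
  G mid /\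
  (forall A B, G A -> G B -> G (mmul A B)) /\
  (forall A, G A -> exists B, G B /\ mmul A B = mid /\ mmul B A = mid) /\
  (forall A B, G A -> G B -> mmul A B = mmul B A).

Definition mdist {N} (A B : mat N) (delta : R) : Prop :=
  forall i j, Cnorm (Csub (A i j) (B i j)) < delta.

Definition IsLieHomAlg (n N : nat) (G : mat N -> Prop)
  (rho : mat N -> series n -> series n) : Prop :=
  (forall A, G A -> IsAut (rho A)) /\
  (forall A B f, G A -> G B -> rho (mmul A B) f = rho A (rho B f)) /\
  (forall (a b : midx n) A eps, G A -> eps > 0 ->
     exists delta, delta > 0 /\
       forall B, G B -> mdist B A delta ->
         Cnorm (Csub (jcoef (rho B) a b) (jcoef (rho A) a b)) < eps).

(* Main.v *)
(** The continuous part costs nothing: since homomorphisms of Lie groups are only required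
    to be continuous, R^q is the image of the torus GL_1(C)^q under z |-> ln |z|. What has to be
    shown is that the image of Z^p lies in the image of R^p x (Z/m)^p.

    For one automorphism g, the coefficients of g^N f are exponential polynomials in N: by
    induction on the degree, the coefficients of the g^N x_i solve a linear recurrence whose
    matrix is the Jacobian of g and whose right hand side involves lower degrees only. Hence
    the exponents come from the group generated by the eigenvalues of the Jacobian. For some
    m >= 1 the m-th powers of these eigenvalues generate a torsion-free group, which has a
    section L of the exponential; then N |-> g^(mN) f extends to real times as an exponential
    polynomial with exponents in L. Such functions are determined by their values on the
    natural numbers, so every identity valid for all g^(mN) persists: the extension is a flow
    of automorphisms and it commutes with everything that commutes with g.

    The flows obtained from the generators of Z^p assemble to a homomorphism Phi on R^p with
    Phi(k) = rho(m k), and (s, e, t) |-> Phi(s - e / m) rho(e, t) depends on e modulo m only.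
    It is pulled back to the diagonal group GL_1(C)^p x (mu_m)^p x GL_1(C)^q. *)

From Stdlib Require Import Reals ZArith List Lra Lia.
From Stdlib Require Import FunctionalExtensionality Classical ClassicalEpsilon.
From Stdlib Require Vectors.Fin.
From mathcomp Require all_boot all_order all_algebra complex Rstruct.
From Coquelicot Require Complex.
Require Import Defs.

(** * Eigenvalues of an invertible matrix *)

(** The operator [A - z] on column vectors; folding it over a list of numbers applies the product of
    the corresponding factors. *)
Definition shifted_mul {n} (A : mat n) (y : Fin.t n -> C) (z : C) : Fin.t n -> C :=
  fun i => Csub (fsum n (fun j => Cmul (A i j) (y j))) (Cmul z (y i)).

Module Spectrum.
Import all_boot all_order all_algebra complex Rstruct.
Import GRing.Theory.
Local Open Scope ring_scope.
Local Notation K := (complex R).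

(** Pairs of reals are identified with an algebraically closed field in which polynomials split and
    Cayley-Hamilton is at hand. *)
Definition cplx (z : C) : K := Complex (fst z) (snd z).
Definition pair_of (z : K) : C := (Re z, Im z).

Lemma pair_ofK : cancel pair_of cplx. Proof. by case. Qed.
Lemma cplxK : cancel cplx pair_of. Proof. by case. Qed.
Lemma cplx_add z w : cplx (Cadd z w) = cplx z + cplx w. Proof. by []. Qed.
Lemma cplx_sub z w : cplx (Csub z w) = cplx z - cplx w. Proof. by []. Qed.
Lemma cplx_mul z w : cplx (Cmul z w) = cplx z * cplx w. Proof. by []. Qed.

Fixpoint fin_of n : 'I_n -> Fin.t n :=
  match n with
  | 0%N => fun i => match not_false_is_true (ltn_ord i) with end
  | m.+1 => fun i => if unlift ord0 i is Some j then Fin.FS (fin_of m j) else Fin.F1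
  end.

Lemma fin_of0 n : fin_of n.+1 ord0 = Fin.F1.
Proof. by rewrite /= unlift_none. Qed.
Lemma fin_of_lift n j : fin_of n.+1 (lift ord0 j) = Fin.FS (fin_of n j).
Proof. by rewrite /= liftK. Qed.

Lemma fin_of_surj n (i : Fin.t n) : exists j, fin_of n j = i.
Proof.
elim: i => [m|m i [j <-]]; first by exists ord0; rewrite fin_of0.
by exists (lift ord0 j); rewrite fin_of_lift.
Qed.

Lemma fin_of_inj n : injective (fin_of n).
Proof.
elim: n => [[]//|n IH] i j.
case: (unliftP ord0 i) => [i'|] ->; case: (unliftP ord0 j) => [j'|] -> //;
  rewrite ?fin_of0 ?fin_of_lift // => /Fin.FS_inj /IH -> //.
Qed.

Lemma cplx_fsum n f : cplx (fsum n f) = \sum_(i < n) cplx (f (fin_of n i)).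
Proof.
elim: n f => [|n IH] f; first by rewrite big_ord0.
rewrite big_ord_recl fin_of0 [fsum _ _]/= cplx_add IH; congr (_ + _).
by apply: eq_bigr => i _; rewrite fin_of_lift.
Qed.

Section Matrix.
Variable n : nat.
Implicit Types A B : Defs.mat n.+1.

(** The size is a successor, so that square matrices form a nonzero ring; the empty size is treated
    apart. *)
Definition mx_of A : 'M[K]_n.+1 := \matrix_(i, j) cplx (A (fin_of _ i) (fin_of _ j)).
Definition col_of (y : Fin.t n.+1 -> C) : 'cV[K]_n.+1 := \col_i cplx (y (fin_of _ i)).

Lemma mx_of_mmul A B : mx_of (mmul A B) = mx_of A *m mx_of B.
Proof.
apply/matrixP => i j; rewrite !mxE cplx_fsum.
by apply: eq_bigr => k _; rewrite !mxE cplx_mul.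
Qed.

Lemma mx_of_mid : mx_of mid = 1%:M.
Proof.
apply/matrixP => i j; rewrite !mxE /mid.
case: Fin.eq_dec => [/fin_of_inj ->|ne]; first by rewrite eqxx.
by case: eqP => // eij; case: ne; rewrite eij.
Qed.

Lemma col_of_shifted_mul A y z :
  col_of (shifted_mul A y z) = (mx_of A - (cplx z)%:M) *m col_of y.
Proof.
rewrite mulmxBl mul_scalar_mx; apply/matrixP => i j.
rewrite !mxE cplx_sub cplx_fsum cplx_mul; congr (_ - _).
by apply: eq_bigr => k _; rewrite !mxE cplx_mul.
Qed.

Lemma col_of_fold A (s : seq K) y :
  col_of (fold_left (shifted_mul A) (List.map pair_of s) y) =
  horner_mx (mx_of A) (\prod_(z <- s) ('X - z%:P)) *m col_of y.
Proof.
elim: s y => [|z s IH] y; first by rewrite big_nil rmorph1 mul1mx.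
rewrite /= IH col_of_shifted_mul pair_ofK big_cons mulrC rmorphM /=.
by rewrite rmorphB /= horner_mx_X horner_mx_C -mulmxA.
Qed.
End Matrix.

(** By Cayley-Hamilton: the characteristic polynomial splits into linear factors and vanishes at the
    matrix, so [l] can be the list of its roots. None of them is zero, since a row vector with
    [v A = 0] satisfies [v = v A A^-1 = 0]. *)
Lemma annihilating_eigenvalues n (A B : mat n) :
  mmul A B = mid ->
  exists l : list C, (forall z, In z l -> z <> C0) /\
    forall y i, fold_left (shifted_mul A) l y i = C0.
Proof.
case: n A B => [|n] A B AB.
  by exists nil; split=> // y; apply: (Fin.case0 (fun i => _)).
have uA : mx_of n A \in unitmx.
  by have := mulmx1_unit (etrans (esym (mx_of_mmul n A B)) (etrans (f_equal _ AB) (mx_of_mid n))) => -[].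
have [s Es] := closed_field_poly_normal (char_poly (mx_of n A)).
move: Es; rewrite (monicP (char_poly_monic _)) scale1r => Es.
exists (List.map pair_of s); split=> [z /in_map_iff[w [<- ws]] w0|y i].
  have {}w0 : w = 0%R by rewrite -(pair_ofK w) w0.
  have : eigenvalue (mx_of n A) 0%R.
    rewrite eigenvalue_root_char Es root_prod_XsubC -w0.
    by elim: s ws {Es} => //= a s IH [->|/IH]; rewrite inE ?eqxx // => ->; rewrite orbT.
  case/eigenvalueP => v; rewrite scale0r => vA; case/eqP.
  by rewrite -(mulmxK uA v) vA mul0mx.
have := col_of_fold n A s y; rewrite -Es Cayley_Hamilton mul0mx => /matrixP E.
have [j <-] := fin_of_surj _ i.
have := E j ord0; rewrite !mxE => /(f_equal pair_of); rewrite cplxK => ->; by [].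
Qed.
End Spectrum.

(** * Complex numbers *)

Declare Scope cx_scope.
Delimit Scope cx_scope with cx.
Infix "+" := Cadd : cx_scope.
Infix "-" := Csub : cx_scope.
Infix "*" := Cmul : cx_scope.
Notation "- z" := (Copp z) : cx_scope.

Definition Cinv (z : C) : C :=
  (fst z / (fst z * fst z + snd z * snd z), - snd z / (fst z * fst z + snd z * snd z)).
Definition Cdiv (z w : C) : C := Cmul z (Cinv w).
Definition RtoC (x : R) : C := (x, 0).

Lemma C_ring : ring_theory C0 C1 Cadd Cmul Csub Copp eq.
Proof.
  constructor; intros; repeat match goal with z : C |- _ => destruct z end;
    unfold Cadd, Cmul, Csub, Copp, Cadd, C0, C1; simpl; f_equal; ring.
Qed.

Lemma C1_neq_C0 : C1 <> C0.
Proof. intros H; injection H; lra. Qed.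

Lemma sum_sqr_neq_0 (z : C) : z <> C0 -> fst z * fst z + snd z * snd z <> 0.
Proof.
  destruct z as [x y]; simpl; intros H E; apply H.
  assert (x = 0) by nra; assert (y = 0) by nra; subst; reflexivity.
Qed.

Lemma C_field : field_theory C0 C1 Cadd Cmul Csub Copp Cdiv Cinv eq.
Proof.
  constructor; [apply C_ring | apply C1_neq_C0 | reflexivity |].
  intros z Hz; apply sum_sqr_neq_0 in Hz; destruct z as [x y].
  unfold Cmul, Cinv, C1; simpl in *; f_equal; field; trivial.
Qed.
Add Field C_field_inst : C_field.

Lemma C_eq_dec (z w : C) : {z = w} + {z <> w}.
Proof.
  destruct z as [x y], w as [x' y'].
  destruct (Req_EM_T x x'), (Req_EM_T y y'); subst; auto;
    right; intros H; injection H; congruence.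
Qed.

Lemma Cmul_integral (z w : C) : (z * w)%cx = C0 -> z = C0 \/ w = C0.
Proof.
  intros H; destruct (C_eq_dec z C0) as [|Hz]; [auto | right].
  transitivity (Cinv z * (z * w))%cx; [field; trivial | rewrite H; ring].
Qed.

Lemma RtoC_add x y : RtoC (x + y) = (RtoC x + RtoC y)%cx.
Proof. unfold RtoC, Cadd; simpl; f_equal; ring. Qed.
Lemma RtoC_sub x y : RtoC (x - y) = (RtoC x - RtoC y)%cx.
Proof. unfold RtoC, Csub, Cadd, Copp; simpl; f_equal; ring. Qed.
Lemma RtoC_mul x y : RtoC (x * y) = (RtoC x * RtoC y)%cx.
Proof. unfold RtoC, Cmul; simpl; f_equal; ring. Qed.
Lemma RtoC_inj x y : RtoC x = RtoC y -> x = y.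
Proof. intros H; injection H; trivial. Qed.

Lemma Cpow_add z m k : Cpow z (m + k) = (Cpow z m * Cpow z k)%cx.
Proof. induction m; simpl; [ring | rewrite IHm; ring]. Qed.
Lemma Cpow_Cpow z m k : Cpow z (m * k) = Cpow (Cpow z m) k.
Proof.
  induction k; [rewrite Nat.mul_0_r; reflexivity|].
  rewrite Nat.mul_succ_r, Nat.add_comm, Cpow_add, IHk; reflexivity.
Qed.
Lemma Cpow_mul z w k : Cpow (z * w)%cx k = (Cpow z k * Cpow w k)%cx.
Proof. induction k; simpl; [ring | rewrite IHk; ring]. Qed.
Lemma Cpow_one k : Cpow C1 k = C1.
Proof. induction k; simpl; [|rewrite IHk]; try ring. Qed.
Lemma Cpow_neq_0 z k : z <> C0 -> Cpow z k <> C0.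
Proof.
  intros Hz; induction k; simpl; [apply C1_neq_C0|].
  intros H; apply Cmul_integral in H; tauto.
Qed.

(** * The complex exponential *)

Definition cexp (z : C) : C := (exp (fst z) * cos (snd z), exp (fst z) * sin (snd z)).

Lemma cexp_add z w : cexp (z + w)%cx = (cexp z * cexp w)%cx.
Proof.
  destruct z, w; unfold cexp, Cadd, Cmul; simpl.
  rewrite exp_plus, cos_plus, sin_plus; f_equal; ring.
Qed.
Lemma cexp_0 : cexp C0 = C1.
Proof. unfold cexp, C0, C1; simpl; rewrite exp_0, cos_0, sin_0; f_equal; ring. Qed.
Lemma cexp_opp z : (cexp (- z) * cexp z)%cx = C1.
Proof. rewrite <- cexp_add, <- cexp_0; f_equal; ring. Qed.
Lemma cexp_neq_0 z : cexp z <> C0.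
Proof.
  intros H; apply C1_neq_C0; rewrite <- (cexp_opp z), H; ring.
Qed.
Lemma cexp_INR k z : cexp (RtoC (INR k) * z)%cx = Cpow (cexp z) k.
Proof.
  induction k as [|k IH].
  - change (RtoC (INR 0)) with C0; replace (C0 * z)%cx with C0 by ring; apply cexp_0.
  - rewrite S_INR, RtoC_add; change (RtoC 1) with C1.
    replace ((RtoC (INR k) + C1) * z)%cx with (z + RtoC (INR k) * z)%cx by ring.
    rewrite cexp_add, IH; reflexivity.
Qed.

Lemma unit_circle_angle x y : x * x + y * y = 1 -> exists a, cos a = x /\ sin a = y.
Proof.
  intros H.
  assert (Hx : -1 <= x <= 1) by nra.
  assert (Hs : sin (acos x) = Rabs y).
  { rewrite sin_acos by lra; rewrite <- sqrt_Rsqr_abs; f_equal; unfold Rsqr; lra. }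
  destruct (Rle_dec 0 y).
  - exists (acos x); rewrite cos_acos, Hs, Rabs_right by lra; auto.
  - exists (- acos x); rewrite cos_neg, sin_neg, cos_acos, Hs, Rabs_left by lra; split; lra.
Qed.

Lemma cexp_surj w : w <> C0 -> exists z, cexp z = w.
Proof.
  intros Hw; apply sum_sqr_neq_0 in Hw; destruct w as [x y]; simpl in Hw.
  set (r := sqrt (x * x + y * y)).
  assert (Hr : 0 < r) by (apply sqrt_lt_R0; nra).
  assert (Hr2 : r * r = x * x + y * y) by (apply sqrt_sqrt; nra).
  destruct (unit_circle_angle (x / r) (y / r)) as [a [Hc Hs]].
  { transitivity ((x * x + y * y) / (r * r)); [field; lra | rewrite Hr2; field; nra]. }
  exists (ln r, a); unfold cexp; simpl; rewrite exp_ln, Hc, Hs by trivial.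
  f_equal; field; lra.
Qed.

(** * Logarithms without resonances *)

(* A group of exponents on which [cexp] is injective: an exponential polynomial with
   exponents in [L] is then determined by its values on the natural numbers. *)
Record exp_lattice (L : C -> Prop) : Prop := {
  lat_0 : L C0;
  lat_add : forall z w, L z -> L w -> L (z + w)%cx;
  lat_opp : forall z, L z -> L (- z)%cx;
  lat_inj : forall z, L z -> cexp z = C1 -> z = C0 }.

Lemma lat_nat L z k : exp_lattice L -> L z -> L (RtoC (INR k) * z)%cx.
Proof.
  intros HL Hz; induction k as [|k IH].
  - replace (RtoC (INR 0) * z)%cx with C0 by (change (RtoC (INR 0)) with C0; ring).
    apply (lat_0 _ HL).
  - replace (RtoC (INR (S k)) * z)%cx with (RtoC (INR k) * z + z)%cx;
      [apply (lat_add _ HL); trivial|].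
    rewrite S_INR, RtoC_add; change (RtoC 1) with C1; ring.
Qed.

Lemma lat_cexp_inj L z w : exp_lattice L -> L z -> L w -> cexp z = cexp w -> z = w.
Proof.
  intros HL Hz Hw E.
  assert (H : (- w + z)%cx = C0).
  { apply (lat_inj _ HL); [apply (lat_add _ HL); trivial; apply (lat_opp _ HL); trivial|].
    rewrite cexp_add, E; apply cexp_opp. }
  transitivity (w + (- w + z))%cx; [ring | rewrite H; ring].
Qed.

Definition zmulC (k : Z) (z : C) : C := (RtoC (IZR k) * z)%cx.

(** A relation [exp(w + k z) = 1] with [k <> 0] would express a positive power of [exp z] as the
    exponential of an element of [L], which is excluded. So [k = 0], and injectivity on [L]
    applies. *)
Lemma exp_lattice_extend L z :
  exp_lattice L ->
  (forall d w, (0 < d)%nat -> L w -> Cpow (cexp z) d <> cexp w) ->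
  exp_lattice (fun v => exists w k, L w /\ v = (w + zmulC k z)%cx).
Proof.
  intros HL Hz; constructor.
  - exists C0, 0%Z; split; [apply (lat_0 _ HL)|]; unfold zmulC; change (RtoC 0) with C0; ring.
  - intros v v' (w & k & Hw & ->) (w' & k' & Hw' & ->).
    exists (w + w')%cx, (k + k')%Z; split; [apply (lat_add _ HL); trivial|].
    unfold zmulC; rewrite plus_IZR, RtoC_add; ring.
  - intros v (w & k & Hw & ->); exists (- w)%cx, (- k)%Z; split; [apply (lat_opp _ HL); trivial|].
    unfold zmulC; rewrite opp_IZR; replace (- IZR k)%R with (0 - IZR k)%R by ring.
    rewrite RtoC_sub; change (RtoC 0) with C0; ring.
  - intros v (w & k & Hw & ->) E; unfold zmulC in *.
    assert (Hneg : forall d w, (0 < d)%nat -> L w ->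
              cexp (w + RtoC (INR d) * z)%cx <> C1).
    { intros d u Hd Hu E'; apply (Hz d (- u)%cx Hd); [apply (lat_opp _ HL); trivial|].
      rewrite <- cexp_INR, <- (cexp_opp u) in *; rewrite cexp_add in E'.
      transitivity (cexp (- u) * (cexp u * cexp (RtoC (INR d) * z)))%cx.
      - transitivity (C1 * cexp (RtoC (INR d) * z))%cx; [ring|].
        rewrite <- (cexp_opp u); ring.
      - rewrite E', cexp_opp; ring. }
    destruct k as [|k|k].
    + change (RtoC 0) with C0 in *; replace (w + C0 * z)%cx with w in * by ring.
      apply (lat_inj _ HL); trivial.
    + exfalso; apply (Hneg (Pos.to_nat k) w); [lia | trivial |].
      rewrite INR_IZR_INZ, positive_nat_Z; trivial.
    + exfalso; apply (Hneg (Pos.to_nat k) (- w)%cx); [lia | apply (lat_opp _ HL); trivial |].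
      rewrite INR_IZR_INZ, positive_nat_Z.
      rewrite <- (cexp_opp (w + RtoC (IZR (Z.neg k)) * z)%cx), E.
      replace (- w + RtoC (IZR (Z.pos k)) * z)%cx with (- (w + RtoC (IZR (Z.neg k)) * z))%cx;
        [ring|].
      change (Z.neg k) with (- Z.pos k)%Z; rewrite opp_IZR.
      replace (- IZR (Z.pos k))%R with (0 - IZR (Z.pos k))%R by ring.
      rewrite RtoC_sub; change (RtoC 0) with C0; ring.
Qed.

(** Induction on the list. If some positive power [z^d] already lies in [exp(L)], then [L] is kept
    and [m] becomes [m d]; otherwise a logarithm of [z^m] is adjoined to [L] as a free generator. *)
Lemma nonresonant_logarithms (l : list C) :
  (forall z, In z l -> z <> C0) ->
  exists m L, (0 < m)%nat /\ exp_lattice L /\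
    forall z, In z l -> exists w, L w /\ cexp w = Cpow z m.
Proof.
  induction l as [|z l IH]; intros Hl.
  - exists 1%nat, (fun w => w = C0); split; [lia | split; [|simpl; tauto]].
    constructor; intros; subst; trivial; ring.
  - destruct IH as (m & L & Hm & HL & Hlog); [intros; apply Hl; right; trivial|].
    destruct (classic (exists d w, (0 < d)%nat /\ L w /\ Cpow z d = cexp w))
      as [(d & w & Hd & Hw & E)|Hno].
    + exists (m * d)%nat, L; split; [nia | split; [trivial|]].
      intros z' [<-|Hz'].
      * exists (RtoC (INR m) * w)%cx; split; [apply lat_nat; trivial|].
        rewrite cexp_INR, <- E, <- Cpow_Cpow; f_equal; lia.
      * destruct (Hlog z' Hz') as (w' & Hw' & E').
        exists (RtoC (INR d) * w')%cx; split; [apply lat_nat; trivial|].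
        rewrite cexp_INR, E', <- Cpow_Cpow; reflexivity.
    + destruct (cexp_surj (Cpow z m)) as [v Hv];
        [apply Cpow_neq_0, Hl; left; trivial|].
      exists m; eexists; split; [trivial | split].
      (* A relation of exponent [d] for [exp v = z^m] is a relation of exponent [m d] for [z]. *)
      * apply (exp_lattice_extend L v HL); intros d w Hd Hw E; apply Hno.
        exists (m * d)%nat, w; split; [nia | split; trivial].
        rewrite Cpow_Cpow, <- Hv; trivial.
      * intros z' [<-|Hz'].
        -- exists v; split; trivial; exists C0, 1%Z; split; [apply (lat_0 _ HL)|].
           unfold zmulC; change (RtoC 1) with C1; ring.
        -- destruct (Hlog z' Hz') as (w' & Hw' & E'); exists w'; split; trivial.
           exists w', 0%Z; split; trivial; unfold zmulC; change (RtoC 0) with C0; ring.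
Qed.

(** * Exponential polynomials *)

(** The binomial polynomial [t (t - 1) ... (t - j + 1) / j!] at a real argument. In this basis the
    forward difference merely lowers the index. *)
Fixpoint bin (j : nat) (t : R) : R :=
  match j with O => 1 | S j' => bin j' t * (t - INR j') / INR (S j') end.

Lemma bin_mul j t : t * bin j t = INR (S j) * bin (S j) t + INR j * bin j t.
Proof.
  cbn [bin]; assert (INR (S j) <> 0) by (apply not_0_INR; lia); field; trivial.
Qed.

Lemma bin_succ j t : bin (S j) (t + 1) = bin (S j) t + bin j t.
Proof.
  revert t; induction j as [|j IH]; intros t; [simpl; field|].
  change (bin (S (S j)) (t + 1)) with (bin (S j) (t + 1) * (t + 1 - INR (S j)) / INR (S (S j))).
  change (bin (S (S j)) t) with (bin (S j) t * (t - INR (S j)) / INR (S (S j))).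
  rewrite IH; pose proof (bin_mul j t) as E.
  assert (H : bin j t * (t - INR j) = INR (S j) * bin (S j) t) by lra.
  rewrite !S_INR in *.
  assert (INR j + 1 + 1 <> 0) by (pose proof (pos_INR j); lra).
  apply Rmult_eq_reg_r with (INR j + 1 + 1); trivial; field_simplify; [|trivial|trivial]; nra.
Qed.

Inductive exp_poly (L : C -> Prop) : (R -> C) -> Prop :=
| exp_poly_term c j l : L l ->
    exp_poly L (fun t => c * RtoC (bin j t) * cexp (RtoC t * l))%cx
| exp_poly_add f g : exp_poly L f -> exp_poly L g -> exp_poly L (fun t => f t + g t)%cx.

Lemma exp_poly_ext L f g : exp_poly L f -> (forall t, g t = f t) -> exp_poly L g.
Proof. intros H E; replace g with f; [trivial | extensionality t; auto]. Qed.

Section ExpPoly.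
Variable L : C -> Prop.
Hypothesis HL : exp_lattice L.
Local Notation EP := (exp_poly L).

Lemma exp_poly_scal c f : EP f -> EP (fun t => c * f t)%cx.
Proof.
  induction 1 as [c' j l Hl|f g _ IHf _ IHg].
  - eapply exp_poly_ext; [apply (exp_poly_term L (c * c')%cx j l Hl)|]; intros; cbn beta; ring.
  - eapply exp_poly_ext; [apply (exp_poly_add L _ _ IHf IHg)|]; intros; cbn beta; ring.
Qed.

Lemma exp_poly_const c : EP (fun _ => c).
Proof.
  eapply exp_poly_ext; [apply (exp_poly_term L c 0 C0 (lat_0 _ HL))|]; intros t; cbn beta.
  replace (RtoC t * C0)%cx with C0 by ring; rewrite cexp_0.
  change (RtoC (bin 0 t)) with C1; ring.
Qed.

Lemma exp_poly_mul_id f : EP f -> EP (fun t => RtoC t * f t)%cx.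
Proof.
  induction 1 as [c j l Hl|f g _ IHf _ IHg].
  - eapply exp_poly_ext.
    + apply (exp_poly_add L _ _ (exp_poly_term L (c * RtoC (INR (S j)))%cx (S j) l Hl)
               (exp_poly_term L (c * RtoC (INR j))%cx j l Hl)).
    + intros t; cbn beta.
      replace (RtoC t * (c * RtoC (bin j t) * cexp (RtoC t * l)))%cx
        with (c * RtoC (t * bin j t) * cexp (RtoC t * l))%cx by (rewrite RtoC_mul; ring).
      rewrite bin_mul, RtoC_add, !RtoC_mul; ring.
  - eapply exp_poly_ext; [apply (exp_poly_add L _ _ IHf IHg)|]; intros; cbn beta; ring.
Qed.

Lemma exp_poly_mul_bin s j f : EP f -> EP (fun t => RtoC (bin j (t + s)) * f t)%cx.
Proof.
  intros Hf; induction j as [|j IH].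
  - eapply exp_poly_ext; [apply Hf|]; intros t; change (RtoC (bin 0 (t + s))) with C1; ring.
  - eapply exp_poly_ext.
    + apply (exp_poly_scal (RtoC (/ INR (S j)))).
      apply exp_poly_add; [apply exp_poly_mul_id, IH|].
      apply (exp_poly_scal (RtoC (s - INR j)) _ IH).
    + intros t; cbn [bin]; unfold Rdiv; rewrite !RtoC_mul, !RtoC_sub, RtoC_add; ring.
Qed.

Lemma exp_poly_mul_cexp s l f :
  L l -> EP f -> EP (fun t => cexp (RtoC (t + s) * l) * f t)%cx.
Proof.
  intros Hl; induction 1 as [c j l' Hl'|f g _ IHf _ IHg].
  - eapply exp_poly_ext;
      [apply (exp_poly_term L (c * cexp (RtoC s * l))%cx j (l + l')%cx (lat_add _ HL _ _ Hl Hl'))|].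
    intros t; cbn beta; rewrite RtoC_add.
    replace (RtoC t * (l + l'))%cx with (RtoC t * l + RtoC t * l')%cx by ring.
    replace ((RtoC t + RtoC s) * l)%cx with (RtoC t * l + RtoC s * l)%cx by ring.
    rewrite !cexp_add; ring.
  - eapply exp_poly_ext; [apply (exp_poly_add L _ _ IHf IHg)|]; intros; cbn beta; ring.
Qed.

(** One induction on the first factor yields both stability under products ([s = 0]) and under
    translations ([g = 1]). *)
Lemma exp_poly_shift_mul s f g : EP f -> EP g -> EP (fun t => f (t + s)%R * g t)%cx.
Proof.
  intros Hf Hg; induction Hf as [c j l Hl|f f' _ IH _ IH'].
  - eapply exp_poly_ext;
      [apply (exp_poly_scal c), (exp_poly_mul_bin s j), (exp_poly_mul_cexp s l _ Hl Hg)|].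
    intros; cbn beta; ring.
  - eapply exp_poly_ext; [apply (exp_poly_add L _ _ IH IH')|]; intros; cbn beta; ring.
Qed.

Lemma exp_poly_mul f g : EP f -> EP g -> EP (fun t => f t * g t)%cx.
Proof.
  intros Hf Hg; eapply exp_poly_ext; [apply (exp_poly_shift_mul 0 f g Hf Hg)|].
  intros t; cbn beta; rewrite Rplus_0_r; reflexivity.
Qed.

Lemma exp_poly_shift s f : EP f -> EP (fun t => f (t + s)).
Proof.
  intros Hf; eapply exp_poly_ext; [apply (exp_poly_shift_mul s f _ Hf (exp_poly_const C1))|].
  intros t; cbn beta; ring.
Qed.

(** By linearity a single term of exponent [v] is enough. For [v <> l] the numbers [exp v] and
    [exp l] differ because the exponents lie in [L], and the equation is solved by descending
    degree. *)
Lemma exp_poly_resolvent l e :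
  L l -> EP e -> exists x, EP x /\ forall t, x (t + 1) = (cexp l * x t + e t)%cx.
Proof.
  intros Hl; induction 1 as [c j v Hv|f g _ [x [Hx Ex]] _ [y [Hy Ey]]].
  - assert (Hstep : forall t, cexp (RtoC (t + 1) * v)%cx = (cexp v * cexp (RtoC t * v))%cx).
    { intros t; rewrite RtoC_add, <- cexp_add; f_equal; change (RtoC 1) with C1; ring. }
    destruct (C_eq_dec v l) as [->|Hvl].
    (* Resonance: the right-hand side has the exponent [l] itself, so the degree of the solution
       goes up by one. *)
    + exists (fun t => (c * Cinv (cexp l)) * RtoC (bin (S j) t) * cexp (RtoC t * l))%cx.
      split; [constructor; trivial|]; intros t.
      rewrite bin_succ, RtoC_add, Hstep; field; apply cexp_neq_0.
    + assert (Hd : (cexp v - cexp l)%cx <> C0).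
      { intros E; apply Hvl; apply (lat_cexp_inj L); trivial.
        transitivity (cexp l + (cexp v - cexp l))%cx; [ring | rewrite E; ring]. }
      revert c; induction j as [|j IH]; intros c.
      * exists (fun t => (c * Cinv (cexp v - cexp l)) * RtoC (bin 0 t) * cexp (RtoC t * v))%cx.
        split; [constructor; trivial|]; intros t.
        change (RtoC (bin 0 (t + 1))) with C1; change (RtoC (bin 0 t)) with C1.
        rewrite Hstep; field; trivial.
      (* Dividing the top term by [exp v - exp l] leaves, by Pascal's rule, a remainder of degree
         [j], which the induction hypothesis removes. *)
      * destruct (IH (- (c * Cinv (cexp v - cexp l) * cexp v))%cx) as [x [Hx Ex]].
        exists (fun t => (c * Cinv (cexp v - cexp l)) * RtoC (bin (S j) t) * cexp (RtoC t * v)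
                         + x t)%cx.
        split; [apply exp_poly_add; [constructor|]; trivial|]; intros t.
        rewrite Ex, bin_succ, RtoC_add, Hstep; field; trivial.
  - exists (fun t => x t + y t)%cx; split; [apply exp_poly_add; trivial|].
    intros t; rewrite Ex, Ey; ring.
Qed.
End ExpPoly.

(** * Normal forms of exponential polynomials and their uniqueness *)

Fixpoint pev (j : nat) (p : list C) (t : R) : C :=
  match p with nil => C0 | c :: p' => (c * RtoC (bin j t) + pev (S j) p' t)%cx end.

Lemma pev_succ j p t : pev (S j) p (t + 1) = (pev (S j) p t + pev j p t)%cx.
Proof.
  revert j; induction p as [|c p IH]; intros j; cbn [pev]; [ring|].
  rewrite IH, bin_succ, RtoC_add; ring.
Qed.

(** The forward difference drops the constant coefficient and moves every other one down by one
    index. *)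
Lemma pev0_succ p t : pev 0 p (t + 1) = (pev 0 p t + pev 0 (tl p) t)%cx.
Proof.
  destruct p as [|c p]; cbn [pev tl]; [ring|]; rewrite pev_succ.
  change (RtoC (bin 0 (t + 1))) with C1; change (RtoC (bin 0 t)) with C1; ring.
Qed.

Lemma pev_map j a p t : pev j (map (Cmul a) p) t = (a * pev j p t)%cx.
Proof. revert j; induction p as [|c p IH]; intros j; cbn [pev map]; [|rewrite IH]; ring. Qed.

Lemma pev_zero j p t : (forall c, In c p -> c = C0) -> pev j p t = C0.
Proof.
  revert j; induction p as [|c p IH]; intros j H; cbn [pev]; [trivial|].
  rewrite (H c), IH; [ring | |]; firstorder.
Qed.

(** The coefficients of [a] times a polynomial plus [b] times its forward difference. The map is
    triangular with diagonal [a], hence injective for [a <> 0]. *)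
Fixpoint lin (a b : C) (p : list C) : list C :=
  match p with nil => nil | c :: p' => (a * c + b * hd C0 p')%cx :: lin a b p' end.

Lemma pev_lin j a b p t : pev j (lin a b p) t = (a * pev j p t + b * pev j (tl p) t)%cx.
Proof.
  revert j; induction p as [|c p IH]; intros j; cbn [pev lin tl]; [ring|].
  rewrite IH; destruct p; cbn [pev tl hd]; ring.
Qed.
Lemma lin_length a b p : length (lin a b p) = length p.
Proof. induction p; simpl; auto. Qed.

Lemma lin_zero a b p :
  a <> C0 -> (forall c, In c (lin a b p) -> c = C0) -> forall c, In c p -> c = C0.
Proof.
  intros Ha; induction p as [|c p IH]; simpl; [tauto|]; intros H.
  assert (Hp : forall c, In c p -> c = C0) by (apply IH; intros; apply H; auto).
  intros c' [<-|Hc']; [|auto].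
  assert (E : (a * c + b * hd C0 p)%cx = C0) by (apply H; auto).
  replace (hd C0 p) with C0 in E by (destruct p; simpl; [|symmetry; apply Hp; left]; trivial).
  replace (a * c + b * C0)%cx with (a * c)%cx in E by ring.
  apply Cmul_integral in E; tauto.
Qed.

Fixpoint padd (p p' : list C) : list C :=
  match p, p' with
  | nil, _ => p'
  | _, nil => p
  | c :: q, c' :: q' => (c + c')%cx :: padd q q'
  end.
Lemma pev_padd j p p' t : pev j (padd p p') t = (pev j p t + pev j p' t)%cx.
Proof.
  revert j p'; induction p as [|c p IH]; intros j [|c' p']; cbn [padd pev]; try ring.
  rewrite IH; ring.
Qed.

Fixpoint nev (s : list (C * list C)) (t : R) : C :=
  match s with
  | nil => C0
  | x :: s' => (pev 0 (snd x) t * cexp (RtoC t * fst x) + nev s' t)%cx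
  end.

Fixpoint ninsert (l : C) (p : list C) (s : list (C * list C)) : list (C * list C) :=
  match s with
  | nil => (l, p) :: nil
  | x :: s' => if C_eq_dec l (fst x) then (l, padd p (snd x)) :: s' else x :: ninsert l p s'
  end.

Lemma nev_ninsert l p s t :
  nev (ninsert l p s) t = (pev 0 p t * cexp (RtoC t * l) + nev s t)%cx.
Proof.
  induction s as [|x s IH]; cbn [ninsert nev fst snd]; [ring|].
  destruct C_eq_dec as [->|]; cbn [nev fst snd]; [rewrite pev_padd | rewrite IH]; ring.
Qed.

Lemma ninsert_keys l p s v : In v (map fst (ninsert l p s)) <-> v = l \/ In v (map fst s).
Proof.
  induction s as [|x s IH]; simpl; [intuition|].
  destruct C_eq_dec as [->|]; simpl; [|rewrite IH]; intuition.
Qed.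

Lemma ninsert_NoDup l p s : NoDup (map fst s) -> NoDup (map fst (ninsert l p s)).
Proof.
  induction s as [|x s IH]; simpl; intros H; [constructor; [simpl; tauto | trivial]|].
  destruct C_eq_dec as [->|Hne]; simpl; [trivial|].
  inversion H; constructor; [rewrite ninsert_keys; intuition | auto].
Qed.

Lemma exp_poly_normal_form L f :
  exp_poly L f ->
  exists s, NoDup (map fst s) /\ (forall l, In l (map fst s) -> L l) /\ forall t, f t = nev s t.
Proof.
  intros Hf.
  (* An accumulator [s] lets a sum be absorbed term by term, so that two normal forms never have to
     be merged. *)
  cut (forall s, NoDup (map fst s) -> (forall l, In l (map fst s) -> L l) ->
    exists s', NoDup (map fst s') /\ (forall l, In l (map fst s') -> L l) /\
      forall t, nev s' t = (f t + nev s t)%cx).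
  { intros H; destruct (H nil) as (s & H1 & H2 & H3); [constructor | simpl; tauto |].
    exists s; repeat split; trivial; intros t; rewrite H3; simpl; ring. }
  induction Hf as [c j l Hl|f g _ IHf _ IHg]; intros s Hs HsL.
  - assert (Hp : exists p, forall t, pev 0 p t = (c * RtoC (bin j t))%cx).
    { exists (repeat C0 j ++ c :: nil); intros t.
      assert (G : forall i, pev i (repeat C0 j ++ c :: nil) t = (c * RtoC (bin (j + i) t))%cx).
      { induction j as [|j IH]; intros i; cbn [repeat app pev]; [simpl; ring|].
        rewrite IH, Nat.add_succ_r; simpl; ring. }
      rewrite G, Nat.add_0_r; reflexivity. }
    destruct Hp as [p Hp]; exists (ninsert l p s); split; [apply ninsert_NoDup; trivial|split].
    + intros v; rewrite ninsert_keys; intros [->|]; auto.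
    + intros t; rewrite nev_ninsert, Hp; reflexivity.
  - destruct (IHf s Hs HsL) as (s' & H1 & H2 & H3).
    destruct (IHg s' H1 H2) as (s'' & H1' & H2' & H3').
    exists s''; repeat split; trivial; intros t; rewrite H3', H3; ring.
Qed.

(** Each exponent counts one more than its number of coefficients, so that discarding an exponent
    without coefficients also lowers the size. *)
Definition nsize (s : list (C * list C)) : nat :=
  fold_right (fun x k => (S (length (snd x)) + k)%nat) O s.

(* The operator [x(t+1) - exp(l) x(t)] shortens the coefficient list at [l] and acts
   invertibly on the others, which allows an induction on the total length. *)
Lemma normal_form_zero k s :
  (nsize s <= k)%nat -> NoDup (map fst s) ->
  (forall l l', In l (map fst s) -> In l' (map fst s) -> cexp l = cexp l' -> l = l') ->
  (forall N, nev s (INR N) = C0) ->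
  forall x c, In x s -> In c (snd x) -> c = C0.
Proof.
  revert s; induction k as [|k IH]; intros s Hk Hnd Hinj Hz; destruct s as [|[l p] s];
    [simpl; tauto | simpl in Hk; lia | simpl; tauto |].
  destruct p as [|c0 p].
  { intros x c [<-|Hx]; [simpl; tauto|].
    apply (IH s); trivial.
    - simpl in Hk; lia.
    - simpl in Hnd; inversion Hnd; trivial.
    - intros; apply Hinj; simpl; auto.
    - intros N; rewrite <- (Hz N); simpl; ring. }
  set (F := fun x : C * list C =>
    (fst x, lin (cexp (fst x) - cexp l)%cx (cexp (fst x)) (snd x))).
  assert (Hkeys : map fst (map F s) = map fst s) by (rewrite map_map; reflexivity).
  assert (Hstep : forall v t, cexp (RtoC (t + 1) * v)%cx = (cexp v * cexp (RtoC t * v))%cx).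
  { intros v t; rewrite RtoC_add, <- cexp_add; f_equal; change (RtoC 1) with C1; ring. }
  assert (HF : forall t, nev (map F s) t = (nev s (t + 1) - cexp l * nev s t)%cx).
  { intros t; clear; induction s as [|x s IH]; cbn [map nev F fst snd]; [ring|].
    rewrite IH, pev_lin, pev0_succ.
    replace (cexp (RtoC (t + 1) * fst x)%cx) with (cexp (fst x) * cexp (RtoC t * fst x))%cx; [ring|].
    rewrite RtoC_add, <- cexp_add; f_equal; change (RtoC 1) with C1; ring. }
  (* The normal form of [x(t+1) - exp(l) x(t)]: at [l] only [exp(l)] times the forward difference
     survives, which is one entry shorter. *)
  assert (H0 : forall x c, In x ((l, map (Cmul (cexp l)) p) :: map F s) -> In c (snd x) -> c = C0).
  { apply IH.
    - assert (Hs : nsize (map F s) = nsize s).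
      { clear; induction s as [|x s IHs]; simpl; [trivial|].
        rewrite IHs, lin_length; reflexivity. }
      simpl in Hk |- *; rewrite Hs, length_map; lia.
    - cbn [map fst]; rewrite Hkeys; trivial.
    - cbn [map fst]; rewrite Hkeys; trivial.
    - intros N; pose proof (Hz N) as E0; pose proof (Hz (S N)) as E1.
      rewrite S_INR in E1; cbn [nev fst snd] in *.
      rewrite pev0_succ, Hstep in E1; cbn [tl] in E1.
      rewrite HF, pev_map.
      transitivity ((pev 0 (c0 :: p) (INR N) + pev 0 p (INR N)) * (cexp l * cexp (RtoC (INR N) * l))
         + nev s (INR N + 1)
         - cexp l * (pev 0 (c0 :: p) (INR N) * cexp (RtoC (INR N) * l) + nev s (INR N)))%cx;
        [ring | rewrite E1, E0; ring]. }
  assert (Hp : forall c, In c p -> c = C0).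
  { intros c Hc; assert (E : (cexp l * c)%cx = C0).
    { apply (H0 (l, map (Cmul (cexp l)) p)); [left; trivial | apply in_map; trivial]. }
    apply Cmul_integral in E; destruct E as [E|E]; trivial; destruct (cexp_neq_0 _ E). }
  assert (Hs : forall x c, In x s -> In c (snd x) -> c = C0).
  { intros x c Hx; revert c; apply (lin_zero (cexp (fst x) - cexp l)%cx (cexp (fst x))).
    - intros E; simpl in Hnd; inversion Hnd as [|? ? Hl Hnd']; apply Hl.
      replace l with (fst x); [apply in_map; trivial|].
      apply Hinj; simpl; auto using in_map.
      transitivity (cexp l + (cexp (fst x) - cexp l))%cx; [ring | rewrite E; ring].
    - intros c Hc; apply (H0 (F x) c); [right; apply in_map|]; trivial. }
  intros x c [<-|Hx]; [|eauto].
  simpl; intros [<-|Hc]; [|auto].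
  (* Only the constant coefficient at [l] is left; the value at 0 isolates it. *)
  specialize (Hz 0%nat); cbn [nev fst snd pev] in Hz.
  assert (E : nev s (INR 0) = C0).
  { clear - Hs; induction s as [|y s IHs]; cbn [nev]; [trivial|].
    rewrite pev_zero, IHs; [ring | |]; intros; [eapply Hs | apply (Hs y)]; simpl; eauto. }
  rewrite E, pev_zero in Hz by trivial.
  change (RtoC (INR 0)) with C0 in Hz; replace (C0 * l)%cx with C0 in Hz by ring.
  rewrite cexp_0 in Hz; change (RtoC (bin 0 (INR 0))) with C1 in Hz.
  rewrite <- Hz; ring.
Qed.

Lemma exp_poly_vanish L f :
  exp_lattice L -> exp_poly L f -> (forall N, f (INR N) = C0) -> forall t, f t = C0.
Proof.
  intros HL Hf Hz t; destruct (exp_poly_normal_form L f Hf) as (s & H1 & H2 & H3).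
  assert (H : forall x c, In x s -> In c (snd x) -> c = C0).
  { apply (normal_form_zero (nsize s)); trivial.
    - intros; apply (lat_cexp_inj L); auto.
    - intros N; rewrite <- H3; trivial. }
  rewrite H3; clear - H; induction s as [|x s IH]; cbn [nev]; [trivial|].
  rewrite pev_zero, IH; [ring | |]; intros; [eapply H | apply (H x)]; simpl; eauto.
Qed.

Lemma exp_poly_unique L f g :
  exp_lattice L -> exp_poly L f -> exp_poly L g -> (forall N, f (INR N) = g (INR N)) ->
  forall t, f t = g t.
Proof.
  intros HL Hf Hg E t.
  assert (H : (f t + Copp C1 * g t)%cx = C0).
  { apply (exp_poly_vanish L (fun t => f t + Copp C1 * g t)%cx HL).
    - apply exp_poly_add; [|apply exp_poly_scal]; trivial.
    - intros N; rewrite E; ring. }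
  transitivity (f t + Copp C1 * g t + g t)%cx; [ring | rewrite H; ring].
Qed.

(** * Coefficients of formal series *)

Lemma fin_case (m : nat) (P : Fin.t (S m) -> Prop) :
  P Fin.F1 -> (forall i, P (Fin.FS i)) -> forall i, P i.
Proof. intros H0 HS i; apply (Fin.caseS' i P); trivial. Qed.

Lemma fsum_ext n f g : (forall i, f i = g i) -> fsum n f = fsum n g.
Proof. intros H; f_equal; extensionality i; auto. Qed.

Lemma fsum_zero n f : (forall i, f i = C0) -> fsum n f = C0.
Proof.
  induction n as [|n IH]; intros H; simpl; [trivial|].
  rewrite H, IH by auto; ring.
Qed.

Lemma fsum_single n f i : (forall j, j <> i -> f j = C0) -> fsum n f = f i.
Proof.
  revert f; induction i as [n|n i IH]; intros f H; simpl.
  - rewrite fsum_zero; [ring|]; intros j; apply H; discriminate.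
  - rewrite (IH (fun j => f (Fin.FS j))), H; [ring | discriminate |].
    intros j Hj; apply H; intros E; apply Fin.FS_inj in E; auto.
Qed.

Lemma fsum_add n f g : fsum n (fun i => f i + g i)%cx = (fsum n f + fsum n g)%cx.
Proof.
  induction n as [|n IH]; simpl; [ring|].
  rewrite (IH (fun i => f (Fin.FS i)) (fun i => g (Fin.FS i))); ring.
Qed.

Lemma fsum_mul_r n f c : fsum n (fun i => f i * c)%cx = (fsum n f * c)%cx.
Proof.
  induction n as [|n IH]; simpl; [ring|]; rewrite (IH (fun i => f (Fin.FS i))); ring.
Qed.

Fixpoint deg (n : nat) : midx n -> nat :=
  match n return midx n -> nat with
  | O => fun _ => O
  | S m => fun a => (a Fin.F1 + deg m (fun i => a (Fin.FS i)))%nat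
  end.
Arguments deg {n} a.

Definition madd {n} (a b : midx n) : midx n := fun i => (a i + b i)%nat.
Definition msub {n} (a b : midx n) : midx n := fun i => (a i - b i)%nat.
Definition mle {n} (a b : midx n) : Prop := forall i, (a i <= b i)%nat.
Definition evar {n} (i : Fin.t n) : midx n := fun j => if Fin.eq_dec i j then 1%nat else O.
Definition X {n} (i : Fin.t n) : series n := mono (evar i).

Lemma deg_madd n (a b : midx n) : deg (madd a b) = (deg a + deg b)%nat.
Proof.
  induction n as [|n IH]; simpl; [trivial|].
  change (fun i => madd a b (Fin.FS i)) with
    (madd (fun i => a (Fin.FS i)) (fun i => b (Fin.FS i))).
  rewrite IH; unfold madd; lia.
Qed.

Lemma deg_midx0 n : deg (midx0 n) = O.
Proof. induction n as [|n IH]; simpl; [trivial | apply IH]. Qed.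

Lemma deg_eq_0 n (a : midx n) : deg a = O -> a = midx0 n.
Proof.
  intros H; extensionality i; revert H; unfold midx0.
  induction i as [n|n i IH]; simpl; intros H; [lia|].
  apply (IH (fun i => a (Fin.FS i))); lia.
Qed.

Lemma deg_evar n (i : Fin.t n) : deg (evar i) = 1%nat.
Proof.
  induction i as [n|n i IH]; cbn [deg].
  - unfold evar at 1; destruct Fin.eq_dec; [|congruence].
    replace (fun i => evar Fin.F1 (Fin.FS i)) with (midx0 n); [rewrite deg_midx0; trivial|].
    extensionality j; unfold evar; destruct Fin.eq_dec; [discriminate | trivial].
  - unfold evar at 1; destruct Fin.eq_dec; [discriminate|].
    replace (fun j => evar (Fin.FS i) (Fin.FS j)) with (evar i); [rewrite IH; trivial|].
    extensionality j; unfold evar.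
    destruct (Fin.eq_dec i j) as [E|E], (Fin.eq_dec (Fin.FS i) (Fin.FS j)) as [E'|E']; trivial;
      exfalso; [subst; auto | apply E, Fin.FS_inj; trivial].
Qed.

Lemma msub_madd n (a b : midx n) : mle b a -> madd (msub a b) b = a.
Proof. intros H; extensionality i; unfold madd, msub; specialize (H i); lia. Qed.

Lemma deg_msub n (a b : midx n) : mle b a -> (deg (msub a b) + deg b = deg a)%nat.
Proof. intros H; rewrite <- deg_madd, msub_madd; trivial. Qed.

Lemma evar_mle n (a : midx n) i : a i <> O -> mle (evar i) a.
Proof. intros H j; unfold evar; destruct Fin.eq_dec; [subst|]; lia. Qed.

Lemma midx_eqb_eq n (a b : midx n) : midx_eqb n a b = true <-> a = b.
Proof.
  split.
  - intros H; extensionality i; revert H.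
    induction i as [n|n i IH]; simpl; intros H; apply Bool.andb_true_iff in H; destruct H as [H1 H2].
    + apply Nat.eqb_eq; trivial.
    + apply (IH (fun i => a (Fin.FS i)) (fun i => b (Fin.FS i))); trivial.
  - intros ->; induction n as [|n IH]; simpl; [trivial|].
    rewrite Nat.eqb_refl, IH; reflexivity.
Qed.

Lemma mono_same n (a : midx n) : mono a a = C1.
Proof. unfold mono; rewrite (proj2 (midx_eqb_eq n a a)); reflexivity. Qed.
Lemma mono_other n (a b : midx n) : a <> b -> mono b a = C0.
Proof.
  intros H; unfold mono; destruct midx_eqb eqn:E; [|trivial].
  apply midx_eqb_eq in E; tauto.
Qed.

Lemma X_midx0 n (i : Fin.t n) : X i (midx0 n) = C0.
Proof.
  apply mono_other; intros E; pose proof (deg_evar n i) as H.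
  rewrite <- E, deg_midx0 in H; lia.
Qed.

Lemma sone_midx0 n : sone (midx0 n) = C1.
Proof. apply mono_same. Qed.
Lemma sone_pos n (a : midx n) : a <> midx0 n -> sone a = C0.
Proof. apply mono_other. Qed.

Lemma fcons_eta m (a : midx (S m)) : fcons (a Fin.F1) (fun i => a (Fin.FS i)) = a.
Proof. extensionality i; revert i; apply fin_case; reflexivity. Qed.

Lemma fcons_mle m j (b : midx m) (a : midx (S m)) :
  (j <= a Fin.F1)%nat -> mle b (fun i => a (Fin.FS i)) -> mle (fcons j b) a.
Proof. intros H1 H2; unfold mle; apply fin_case; simpl; auto. Qed.

Lemma natsum_closed T (V : (T -> C) -> Prop) k (F : T -> nat -> C) :
  (forall f g, V f -> V g -> V (fun x => f x + g x)%cx) ->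
  (forall j, (j <= k)%nat -> V (fun x => F x j)) -> V (fun x => natsum k (F x)).
Proof.
  intros Hadd; induction k as [|k IH]; intros H; simpl; [auto|].
  apply (Hadd (fun x => natsum k (F x))); [apply IH; auto | auto].
Qed.

(** [V] stands for a class of number-valued functions of a parameter in [T]. In this form one
    argument about coefficients serves exponential polynomials, interpolable sequences and
    continuous functions alike. *)
Lemma boxsum_closed T (V : (T -> C) -> Prop) n (a : midx n) (F : T -> midx n -> C) :
  (forall f g, V f -> V g -> V (fun x => f x + g x)%cx) ->
  (forall b, mle b a -> V (fun x => F x b)) -> V (fun x => boxsum n a (F x)).
Proof.
  intros Hadd; revert a F; induction n as [|n IH]; intros a F H; simpl.
  - apply H; intros i; apply (Fin.case0 (fun i => _) i).
  - apply natsum_closed; [trivial|]; intros j Hj.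
    apply (IH _ (fun x b => F x (fcons j b))); intros b Hb; apply H, fcons_mle; trivial.
Qed.

Lemma natsum_zero k g : (forall j, (j <= k)%nat -> g j = C0) -> natsum k g = C0.
Proof. induction k as [|k IH]; intros H; simpl; [auto|]; rewrite IH, H by auto; ring. Qed.

Lemma natsum_single k g j0 :
  (j0 <= k)%nat -> (forall j, (j <= k)%nat -> j <> j0 -> g j = C0) -> natsum k g = g j0.
Proof.
  induction k as [|k IH]; intros Hj H; simpl; [f_equal; lia|].
  destruct (Nat.eq_dec j0 (S k)) as [->|Hne].
  - rewrite natsum_zero; [ring|]; intros; apply H; lia.
  - rewrite IH, (H (S k)) by (intros; try apply H; lia); ring.
Qed.

Lemma boxsum_zero n (a : midx n) F : (forall b, mle b a -> F b = C0) -> boxsum n a F = C0.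
Proof.
  (* A single sum is a family over a one-point parameter space, and the class consists of the
     vanishing ones. *)
  intros H; apply (boxsum_closed unit (fun f => f tt = C0) n a (fun _ => F)); [|auto].
  intros f g -> ->; ring.
Qed.

Lemma boxsum_single n (a b0 : midx n) F :
  mle b0 a -> (forall b, mle b a -> b <> b0 -> F b = C0) -> boxsum n a F = F b0.
Proof.
  revert a b0 F; induction n as [|n IH]; intros a b0 F Hb H; simpl.
  - f_equal; extensionality i; apply (Fin.case0 (fun i => _) i).
  - rewrite (natsum_single _ _ (b0 Fin.F1)); [|apply Hb|].
    + rewrite (IH _ (fun i => b0 (Fin.FS i))); [rewrite fcons_eta; trivial | intros i; apply Hb |].
      intros b Hb' Hne; apply H; [apply fcons_mle; [apply Hb | trivial]|].
      intros E; apply Hne; rewrite <- E; reflexivity.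
    + intros j Hj Hne; apply boxsum_zero; intros b Hb'; apply H; [apply fcons_mle; trivial|].
      intros E; apply Hne; rewrite <- E; reflexivity.
Qed.

Lemma smul_midx0 n (f g : series n) : smul f g (midx0 n) = (f (midx0 n) * g (midx0 n))%cx.
Proof.
  unfold smul; rewrite (boxsum_single n _ (midx0 n)); [reflexivity | intros i; lia |].
  intros b Hb Hne; exfalso; apply Hne; extensionality i; specialize (Hb i).
  unfold midx0 in *; lia.
Qed.

Lemma smul_X_pos n (i : Fin.t n) (h : series n) a :
  a i <> O -> smul (X i) h a = h (msub a (evar i)).
Proof.
  intros Ha; unfold smul, X; rewrite (boxsum_single n _ (evar i)); [|apply evar_mle; trivial|].
  - rewrite mono_same; unfold msub; ring.
  - intros b _ Hb; rewrite mono_other by trivial; ring.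
Qed.

Lemma smul_X_zero n (i : Fin.t n) (h : series n) a : a i = O -> smul (X i) h a = C0.
Proof.
  intros Ha; unfold smul, X; apply boxsum_zero; intros b Hb.
  rewrite mono_other; [ring|]; intros ->; specialize (Hb i); unfold evar in Hb.
  destruct Fin.eq_dec; [lia | congruence].
Qed.

Record alg_closed {T} (V : (T -> C) -> Prop) : Prop := {
  alg_const : forall c, V (fun _ => c);
  alg_add : forall f g, V f -> V g -> V (fun x => f x + g x)%cx;
  alg_mul : forall f g, V f -> V g -> V (fun x => f x * g x)%cx }.

Lemma alg_ext T (V : (T -> C) -> Prop) f g : V f -> (forall x, g x = f x) -> V g.
Proof. intros H E; replace g with f; [trivial | extensionality x; auto]. Qed.

Lemma fsum_closed T (V : (T -> C) -> Prop) n (F : T -> Fin.t n -> C) :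
  alg_closed V -> (forall i, V (fun x => F x i)) -> V (fun x => fsum n (F x)).
Proof.
  intros HV; induction n as [|n IH]; intros H; simpl; [apply (alg_const _ HV)|].
  apply (alg_add _ HV (fun x => F x Fin.F1)); [auto|].
  apply (IH (fun x i => F x (Fin.FS i))); auto.
Qed.

(** Since [F] has no constant term, the top coefficient of [G] is multiplied by zero, and only
    coefficients of [G] of lower degree enter. *)
Lemma smul_closed_left T (V : (T -> C) -> Prop) n (F G : T -> series n) a :
  alg_closed V -> (forall x, F x (midx0 n) = C0) ->
  (forall b, (deg b <= deg a)%nat -> V (fun x => F x b)) ->
  (forall b, (deg b < deg a)%nat -> V (fun x => G x b)) ->
  V (fun x => smul (F x) (G x) a).
Proof.
  intros HV F0 HF HG; unfold smul.
  apply (boxsum_closed T V n a (fun x b => F x b * G x (msub a b))%cx); [apply (alg_add _ HV)|].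
  intros b Hb; pose proof (deg_msub n a b Hb) as Hd.
  destruct (Nat.eq_dec (deg b) 0) as [E|E].
  - apply deg_eq_0 in E; subst b; eapply alg_ext; [apply (alg_const _ HV C0)|].
    intros x; simpl; rewrite F0; ring.
  - apply (alg_mul _ HV (fun x => F x b)); [apply HF | apply HG]; lia.
Qed.

(** With both constant terms zero the two extreme products disappear, so each factor enters in
    degrees strictly below that of [a]. *)
Lemma smul_closed_both T (V : (T -> C) -> Prop) n (F G : T -> series n) a :
  alg_closed V -> (forall x, F x (midx0 n) = C0) -> (forall x, G x (midx0 n) = C0) ->
  (forall b, (deg b < deg a)%nat -> V (fun x => F x b)) ->
  (forall b, (deg b < deg a)%nat -> V (fun x => G x b)) ->
  V (fun x => smul (F x) (G x) a).
Proof.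
  intros HV F0 G0 HF HG; unfold smul.
  apply (boxsum_closed T V n a (fun x b => F x b * G x (msub a b))%cx); [apply (alg_add _ HV)|].
  intros b Hb; pose proof (deg_msub n a b Hb) as Hd.
  destruct (Nat.eq_dec (deg b) 0) as [E|E]; [|destruct (Nat.eq_dec (deg (msub a b)) 0) as [E'|E']].
  - apply deg_eq_0 in E; subst b; eapply alg_ext; [apply (alg_const _ HV C0)|].
    intros x; simpl; rewrite F0; ring.
  - apply deg_eq_0 in E'; eapply alg_ext; [apply (alg_const _ HV C0)|].
    intros x; simpl; rewrite E', G0; ring.
  - apply (alg_mul _ HV (fun x => F x b)); [apply HF | apply HG]; lia.
Qed.

Definition ssum {n} k (F : Fin.t k -> series n) : series n := fun a => fsum k (fun i => F i a).

(* The Euler weights [(b_i + 1) / (|b| + 1)] make [sum_i x_i * sdiv i f] count every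
   monomial of positive degree exactly once. *)
Definition sdiv {n} (i : Fin.t n) (f : series n) : series n :=
  fun b => (RtoC (INR (S (b i)) / INR (S (deg b))) * f (madd b (evar i)))%cx.

Lemma fsum_RtoC n (a : midx n) D :
  fsum n (fun i => RtoC (INR (a i) / D)) = RtoC (INR (deg a) / D).
Proof.
  induction n as [|n IH]; simpl; [unfold RtoC, Rdiv; rewrite Rmult_0_l; trivial|].
  rewrite (IH (fun i => a (Fin.FS i))), plus_INR, <- RtoC_add; f_equal.
  unfold Rdiv; ring.
Qed.

Lemma euler_decomposition n (f : series n) :
  f = sadd (sscal (f (midx0 n)) sone) (ssum n (fun i => smul (X i) (sdiv i f))).
Proof.
  extensionality a; unfold sadd, sscal, ssum.
  destruct (Nat.eq_dec (deg a) 0) as [E|E].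
  - apply deg_eq_0 in E; subst a; rewrite sone_midx0, fsum_zero; [ring|].
    intros i; apply smul_X_zero; reflexivity.
  - rewrite sone_pos by (intros ->; rewrite deg_midx0 in E; lia).
    rewrite (fsum_ext n _ (fun i => RtoC (INR (a i) / INR (deg a)) * f a)%cx).
    + rewrite fsum_mul_r, fsum_RtoC; unfold Rdiv; rewrite Rinv_r by (apply not_0_INR; trivial).
      change (RtoC 1) with C1; ring.
    + intros i; destruct (Nat.eq_dec (a i) 0) as [Ei|Ei].
      * rewrite smul_X_zero, Ei by trivial; simpl; unfold Rdiv; rewrite Rmult_0_l.
        change (RtoC 0) with C0; ring.
      * rewrite smul_X_pos by trivial; unfold sdiv.
        pose proof (evar_mle n a i Ei) as Hle; pose proof (deg_msub n a _ Hle) as Hd.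
        rewrite deg_evar in Hd; rewrite msub_madd by trivial.
        replace (S (deg (msub a (evar i)))) with (deg a) by lia.
        replace (S (msub a (evar i) i)) with (a i); [trivial|].
        specialize (Hle i); unfold msub, evar in *; destruct Fin.eq_dec; [lia | congruence].
Qed.

(** * Coefficients of the images under automorphisms *)

Section Automorphisms.
Variable n : nat.
Implicit Types Phi : series n -> series n.

Lemma aut_add Phi f g : IsAut Phi -> Phi (sadd f g) = sadd (Phi f) (Phi g).
Proof. intros H; apply H. Qed.
Lemma aut_scal Phi c f : IsAut Phi -> Phi (sscal c f) = sscal c (Phi f).
Proof. intros H; apply H. Qed.
Lemma aut_mul Phi f g : IsAut Phi -> Phi (smul f g) = smul (Phi f) (Phi g).
Proof. intros H; apply H. Qed.
Lemma aut_one Phi : IsAut Phi -> Phi sone = sone.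
Proof. intros H; apply H. Qed.
Lemma aut_maximal Phi f : IsAut Phi -> f (midx0 n) = C0 -> Phi f (midx0 n) = C0.
Proof. intros H; apply H. Qed.

Lemma aut_inj Phi f g : IsAut Phi -> Phi f = Phi g -> f = g.
Proof.
  intros (_ & _ & _ & _ & (Psi & H & _) & _) E; rewrite <- (H f), E; apply H.
Qed.

Lemma aut_ssum Phi k (F : Fin.t k -> series n) :
  IsAut Phi -> Phi (ssum k F) = ssum k (fun i => Phi (F i)).
Proof.
  intros H; induction k as [|k IH].
  - replace (ssum 0 F) with (sscal C0 (@sone n)).
    + rewrite aut_scal, aut_one by trivial; extensionality a.
      unfold sscal, ssum; simpl; ring.
    + extensionality a; unfold sscal, ssum; simpl; ring.
  - change (ssum (S k) F) with (sadd (F Fin.F1) (ssum k (fun i => F (Fin.FS i)))).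
    rewrite aut_add, IH by trivial; reflexivity.
Qed.

(** A recursion on the degree: [Phi (X i)] has no constant term, so only lower coefficients of
    [Phi (sdiv i f)] contribute. The finite decomposition of [f] takes the place of an expansion
    into infinitely many monomials and of the [m]-adic continuity of [Phi]. *)
Lemma aut_euler Phi f a :
  IsAut Phi ->
  Phi f a = (f (midx0 n) * sone a
             + fsum n (fun i => smul (Phi (X i)) (Phi (sdiv i f)) a))%cx.
Proof.
  intros H; rewrite (euler_decomposition n f) at 1.
  rewrite aut_add, aut_scal, aut_one, aut_ssum by trivial; unfold sadd, sscal, ssum.
  f_equal; apply fsum_ext; intros i; rewrite aut_mul by trivial; reflexivity.
Qed.

Lemma aut_constant_term Phi f : IsAut Phi -> Phi f (midx0 n) = f (midx0 n).
Proof.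
  intros H; rewrite (aut_euler Phi f) by trivial; rewrite sone_midx0, fsum_zero; [ring|].
  intros i; rewrite smul_midx0, aut_maximal by (trivial; apply X_midx0); ring.
Qed.

Lemma aut_family_closed T (V : (T -> C) -> Prop) (H : T -> series n -> series n) d :
  alg_closed V -> (forall x, IsAut (H x)) ->
  (forall i a, (deg a <= d)%nat -> V (fun x => H x (X i) a)) ->
  forall a (F : T -> series n), (deg a <= d)%nat -> (forall b, V (fun x => F x b)) ->
  V (fun x => H x (F x) a).
Proof.
  intros HV HH HX a.
  remember (deg a) as k eqn:Ek; revert a Ek.
  induction k as [k IH] using (well_founded_induction lt_wf); intros a -> F Hd HF.
  eapply alg_ext; [|intros x; apply aut_euler, HH].
  apply (alg_add _ HV (fun x => F x (midx0 n) * sone a)%cx);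
    [apply (alg_mul _ HV (fun x => F x (midx0 n))); [apply HF | apply (alg_const _ HV)]|].
  apply (fsum_closed T V n (fun x i => smul (H x (X i)) (H x (sdiv i (F x))) a) HV); intros i.
  apply (smul_closed_left T V n (fun x => H x (X i)) (fun x => H x (sdiv i (F x)))); trivial.
  - intros x; apply aut_maximal; [auto | apply X_midx0].
  - intros b Hb; apply HX; lia.
  - intros b Hb; apply (IH (deg b) Hb b eq_refl (fun x => sdiv i (F x))); [lia|].
    intros c; apply (alg_mul _ HV (fun _ => _)); [apply (alg_const _ HV) | apply HF].
Qed.

End Automorphisms.

(** * Continuity *)

(** [near d] is the ball of radius [d] about [x0]. It is left abstract in order to cover real
    numbers, vectors, and matrices restricted to a group. *)
Definition cont_at {T} (near : R -> T -> Prop) (x0 : T) (F : T -> C) : Prop :=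
  forall eps, eps > 0 -> exists delta, delta > 0 /\
    forall x, near delta x -> Cnorm (F x - F x0)%cx < eps.
Definition rcont_at {T} (near : R -> T -> Prop) (x0 : T) (u : T -> R) : Prop :=
  forall eps, eps > 0 -> exists delta, delta > 0 /\
    forall x, near delta x -> Rabs (u x - u x0) < eps.
(** Balls grow with the radius, so that the minimum of two radii serves two conditions at once. *)
Definition antitone {T} (near : R -> T -> Prop) : Prop :=
  forall d d' x, d <= d' -> near d x -> near d' x.

Lemma Cnorm_Cmod z : Cnorm z = Complex.Cmod z.
Proof. unfold Cnorm, Complex.Cmod; f_equal; simpl; ring. Qed.
Lemma Cnorm_mul z w : Cnorm (z * w)%cx = Cnorm z * Cnorm w.
Proof. rewrite !Cnorm_Cmod; apply Complex.Cmod_mult. Qed.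
Lemma Cnorm_triangle z w : Cnorm (z + w)%cx <= Cnorm z + Cnorm w.
Proof. rewrite !Cnorm_Cmod; apply Complex.Cmod_triangle. Qed.
Lemma Cnorm_ge_0 z : 0 <= Cnorm z.
Proof. apply sqrt_pos. Qed.
Lemma Cnorm_C0 : Cnorm C0 = 0.
Proof. unfold Cnorm, C0; simpl; replace (0 * 0 + 0 * 0) with 0 by ring; apply sqrt_0. Qed.
Lemma Cnorm_eq_0 z : Cnorm z = 0 -> z = C0.
Proof. rewrite Cnorm_Cmod; apply Complex.Cmod_eq_0. Qed.

Lemma Cnorm_pair_lt x y e : Rabs x < e / 2 -> Rabs y < e / 2 -> Cnorm (x, y) < e.
Proof.
  intros Hx Hy; unfold Cnorm; simpl.
  assert (H : 0 < e) by (pose proof (Rabs_pos x); lra).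
  rewrite <- (sqrt_square e) by lra; apply sqrt_lt_1_alt.
  apply Rabs_def2 in Hx; apply Rabs_def2 in Hy; split; nra.
Qed.

Section Continuity.
Variables (T : Type) (near : R -> T -> Prop) (x0 : T).
Hypothesis Hnear : antitone near.

Lemma cont_pair (u v : T -> R) :
  rcont_at near x0 u -> rcont_at near x0 v -> cont_at near x0 (fun x => (u x, v x)).
Proof.
  intros Hu Hv eps He.
  destruct (Hu (eps / 2)) as (d & Hd & Hd'); [lra|].
  destruct (Hv (eps / 2)) as (d2 & Hd2 & Hd2'); [lra|].
  exists (Rmin d d2); split; [apply Rmin_pos; trivial|]; intros x Hx.
  unfold Csub, Cadd, Copp; simpl; apply Cnorm_pair_lt.
  - apply Hd', (Hnear (Rmin d d2)); [apply Rmin_l | trivial].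
  - apply Hd2', (Hnear (Rmin d d2)); [apply Rmin_r | trivial].
Qed.

Lemma cont_at_alg : alg_closed (cont_at near x0).
Proof.
  constructor.
  - intros c eps He; exists 1; split; [lra|]; intros x _.
    replace (c - c)%cx with C0 by ring; rewrite Cnorm_C0; trivial.
  - intros f g Hf Hg eps He.
    destruct (Hf (eps / 2)) as (d & Hd & Hd'); [lra|].
    destruct (Hg (eps / 2)) as (d2 & Hd2 & Hd2'); [lra|].
    exists (Rmin d d2); split; [apply Rmin_pos; trivial|]; intros x Hx.
    assert (H1 : near d x) by (apply (Hnear (Rmin d d2)); [apply Rmin_l | trivial]).
    assert (H2 : near d2 x) by (apply (Hnear (Rmin d d2)); [apply Rmin_r | trivial]).
    replace (f x + g x - (f x0 + g x0))%cx with ((f x - f x0) + (g x - g x0))%cx by ring.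
    pose proof (Cnorm_triangle (f x - f x0)%cx (g x - g x0)%cx).
    specialize (Hd' x H1); specialize (Hd2' x H2); lra.
  - intros f g Hf Hg eps He.
    (* If both increments are below [e <= 1], the increment of the product is below
       [e (1 + |f x0| + |g x0|) = e M], and [e <= eps / M]. *)
    set (M := 1 + Cnorm (f x0) + Cnorm (g x0)).
    assert (HM : 1 <= M) by (unfold M; pose proof (Cnorm_ge_0 (f x0));
                             pose proof (Cnorm_ge_0 (g x0)); lra).
    set (e := Rmin 1 (eps / M)).
    assert (He' : 0 < e) by (apply Rmin_pos; [lra | apply Rdiv_lt_0_compat; lra]).
    destruct (Hf e He') as (d & Hd & Hd'); destruct (Hg e He') as (d2 & Hd2 & Hd2').
    exists (Rmin d d2); split; [apply Rmin_pos; trivial|]; intros x Hx.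
    assert (H1 : near d x) by (apply (Hnear (Rmin d d2)); [apply Rmin_l | trivial]).
    assert (H2 : near d2 x) by (apply (Hnear (Rmin d d2)); [apply Rmin_r | trivial]).
    specialize (Hd' x H1); specialize (Hd2' x H2).
    replace (f x * g x - f x0 * g x0)%cx with
      ((f x - f x0) * (g x - g x0) + (f x0 * (g x - g x0) + g x0 * (f x - f x0)))%cx by ring.
    pose proof (Cnorm_triangle ((f x - f x0) * (g x - g x0))%cx
                  (f x0 * (g x - g x0) + g x0 * (f x - f x0))%cx) as T1.
    pose proof (Cnorm_triangle (f x0 * (g x - g x0))%cx (g x0 * (f x - f x0))%cx) as T2.
    rewrite !Cnorm_mul in *.
    pose proof (Cnorm_ge_0 (f x0)); pose proof (Cnorm_ge_0 (g x0)).
    pose proof (Cnorm_ge_0 (f x - f x0)%cx); pose proof (Cnorm_ge_0 (g x - g x0)%cx).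
    assert (E1 : e <= 1) by apply Rmin_l.
    assert (E2 : e * M <= eps).
    { assert (e <= eps / M) by apply Rmin_r.
      apply Rle_trans with (eps / M * M); [apply Rmult_le_compat_r; lra|].
      right; field; lra. }
    set (P := Cnorm (f x - f x0)%cx) in *; set (Q := Cnorm (g x - g x0)%cx) in *.
    assert (P * Q < e * 1) by nra.
    assert (Cnorm (f x0) * Q <= Cnorm (f x0) * e) by nra.
    assert (Cnorm (g x0) * P <= Cnorm (g x0) * e) by nra.
    unfold M in E2; nra.
Qed.
End Continuity.

Definition near_R (t0 : R) (d : R) (t : R) : Prop := Rabs (t - t0) < d.
Definition near_V {q} (s0 : Fin.t q -> R) (d : R) (s : Fin.t q -> R) : Prop :=
  forall i, Rabs (s i - s0 i) < d.

Lemma near_R_antitone t0 : antitone (near_R t0).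
Proof. intros d d' x H; unfold near_R; lra. Qed.
Lemma near_V_antitone q (s0 : Fin.t q -> R) : antitone (near_V s0).
Proof. intros d d' x H H' i; specialize (H' i); lra. Qed.

Lemma rcont_at_continuity_pt u t0 : continuity_pt u t0 -> rcont_at (near_R t0) t0 u.
Proof.
  intros H eps He; destruct (H eps He) as (d & Hd & Hd').
  exists d; split; [trivial|]; intros t Ht.
  (* [continuity_pt] speaks of points other than [t0] only, so [t = t0] is a separate case. *)
  destruct (Req_dec t0 t) as [<-|Hne].
  - unfold Rminus; rewrite Rplus_opp_r, Rabs_R0; trivial.
  - apply (Hd' t); split; [split; [exact I | trivial] | exact Ht].
Qed.

Lemma rcont_uniform T (near : R -> T -> Prop) x0 q (u : T -> Fin.t q -> R) :
  antitone near -> (forall i, rcont_at near x0 (fun x => u x i)) ->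
  forall eps, eps > 0 -> exists d, d > 0 /\ forall x, near d x -> near_V (u x0) eps (u x).
Proof.
  intros Hn Hu eps He; induction q as [|q IH].
  - exists 1; split; [lra|]; intros x _ i; apply (Fin.case0 (fun i => _) i).
  - destruct (IH (fun x i => u x (Fin.FS i))) as (d & Hd & Hd'); [intros i; apply Hu|].
    destruct (Hu Fin.F1 eps He) as (d2 & Hd2 & Hd2').
    exists (Rmin d d2); split; [apply Rmin_pos; trivial|]; intros x Hx.
    unfold near_V; apply fin_case.
    + apply Hd2', (Hn (Rmin d d2)); [apply Rmin_r | trivial].
    + intros i; apply (Hd' x), (Hn (Rmin d d2)); [apply Rmin_l | trivial].
Qed.

Lemma cont_comp_V T (near : R -> T -> Prop) x0 q (u : T -> Fin.t q -> R) F :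
  antitone near -> (forall i, rcont_at near x0 (fun x => u x i)) ->
  cont_at (near_V (u x0)) (u x0) F -> cont_at near x0 (fun x => F (u x)).
Proof.
  intros Hn Hu HF eps He; destruct (HF eps He) as (d & Hd & Hd').
  destruct (rcont_uniform T near x0 q u Hn Hu d Hd) as (d2 & Hd2 & Hd2').
  exists d2; split; auto.
Qed.

Lemma cont_comp_R T (near : R -> T -> Prop) x0 (u : T -> R) F :
  rcont_at near x0 u -> cont_at (near_R (u x0)) (u x0) F -> cont_at near x0 (fun x => F (u x)).
Proof.
  intros Hu HF eps He; destruct (HF eps He) as (d & Hd & Hd').
  destruct (Hu d Hd) as (d2 & Hd2 & Hd2').
  exists d2; split; [trivial|]; intros x Hx; apply Hd'; unfold near_R; auto.
Qed.

Lemma exp_poly_cont L f t0 : exp_poly L f -> cont_at (near_R t0) t0 f.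
Proof.
  pose proof (cont_at_alg R (near_R t0) t0 (near_R_antitone t0)) as HV.
  induction 1 as [c j l _|f g _ IHf _ IHg]; [|apply (alg_add _ HV); trivial].
  assert (HR : forall u, continuity u -> cont_at (near_R t0) t0 (fun t => RtoC (u t))).
  { intros u Hu; apply (cont_pair R (near_R t0) t0 (near_R_antitone t0) u (fun _ => 0));
      apply rcont_at_continuity_pt; [apply Hu | apply continuity_pt_const; intros ? ?; reflexivity]. }
  apply (alg_mul _ HV (fun t => c * RtoC (bin j t))%cx).
  - apply (alg_mul _ HV (fun _ => c)); [apply (alg_const _ HV)|].
    apply HR; induction j as [|j IH]; cbn [bin].
    + apply continuity_const; intros ? ?; reflexivity.
    + unfold Rdiv; apply continuity_mult; [apply continuity_mult; [trivial|]|].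
      * intros t; reg.
      * apply continuity_const; intros ? ?; reflexivity.
  - unfold cexp, Cmul, RtoC; simpl.
    apply (cont_pair R (near_R t0) t0 (near_R_antitone t0)); apply rcont_at_continuity_pt; reg.
Qed.

(** * Embedding a power of an automorphism in a flow *)

(* Only the restriction of [x] to each residue class modulo [m] is an exponential polynomial:
   the eigenvalues themselves may differ by roots of unity, their [m]-th powers may not. *)
Definition interp_seq (L : C -> Prop) (m : nat) (x : nat -> C) : Prop :=
  forall k, exists f, exp_poly L f /\ forall N, x (m * N + k)%nat = f (INR N).

Section Interpolation.
Variables (L : C -> Prop) (m : nat).
Hypothesis HL : exp_lattice L.
Local Notation E0 := (interp_seq L m).

Lemma interp_seq_alg : alg_closed E0.
Proof.
  constructor.
  - intros c k; exists (fun _ => c); split; [apply exp_poly_const|]; trivial.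
  - intros x y Hx Hy k; destruct (Hx k) as (f & Hf & Ef), (Hy k) as (g & Hg & Eg).
    exists (fun t => f t + g t)%cx; split; [apply exp_poly_add; trivial|].
    intros N; rewrite Ef, Eg; trivial.
  - intros x y Hx Hy k; destruct (Hx k) as (f & Hf & Ef), (Hy k) as (g & Hg & Eg).
    exists (fun t => f t * g t)%cx; split; [apply exp_poly_mul; trivial|].
    intros N; rewrite Ef, Eg; trivial.
Qed.

Lemma interp_seq_shift x j : E0 x -> E0 (fun N => x (N + j)%nat).
Proof.
  intros Hx k; destruct (Hx (k + j)%nat) as (f & Hf & Ef); exists f; split; [trivial|].
  intros N; rewrite <- Ef; f_equal; lia.
Qed.

(** Iterating the recurrence [m] times gives one with step [m] and multiplier [z^m = exp w]. On each
    residue class this has step one, and its exponent [w] lies in [L]. *)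
Lemma interp_seq_resolvent y z w :
  L w -> cexp w = Cpow z m -> E0 (fun N => y (S N) - z * y N)%cx -> E0 y.
Proof.
  intros Hw Ew He.
  assert (Hk : forall k, E0 (fun N => y (N + k)%nat - Cpow z k * y N)%cx).
  { induction k as [|k IH].
    - eapply alg_ext; [apply (alg_const _ interp_seq_alg C0)|]; intros N; cbn [Cpow].
      rewrite Nat.add_0_r; ring.
    - eapply alg_ext.
      + apply (alg_add _ interp_seq_alg); [apply (interp_seq_shift _ k He)|].
        apply (alg_mul _ interp_seq_alg _ _ (alg_const _ interp_seq_alg z) IH).
      + intros N; cbn [Cpow]; rewrite Nat.add_succ_r; ring. }
  intros k; destruct (Hk m k) as (e & He' & Ee).
  destruct (exp_poly_resolvent L HL w e Hw He') as (x & Hx & Ex).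
  (* A multiple of the homogeneous solution [exp(t w)] adjusts the particular solution to the
     initial value [y k]. *)
  exists (fun t => x t + (y k - x 0) * RtoC (bin 0 t) * cexp (RtoC t * w))%cx; split.
  { apply exp_poly_add; [|constructor]; trivial. }
  induction N as [|N IH].
  - rewrite Nat.mul_0_r; change (RtoC (bin 0 (INR 0))) with C1; simpl (INR 0).
    change (RtoC 0) with C0; replace (C0 * w)%cx with C0 by ring; rewrite cexp_0; simpl; ring.
  - specialize (Ee N); cbn beta in Ee.
    replace (m * S N + k)%nat with (m * N + k + m)%nat by lia.
    transitivity (Cpow z m * y (m * N + k)%nat
                  + (y (m * N + k + m)%nat - Cpow z m * y (m * N + k)%nat))%cx; [ring|].
    rewrite Ee, IH, <- Ew, S_INR, Ex, RtoC_add.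
    replace ((RtoC (INR N) + RtoC 1) * w)%cx with (w + RtoC (INR N) * w)%cx
      by (change (RtoC 1) with C1; ring).
    rewrite cexp_add; change (RtoC (bin 0 (INR N + 1))) with C1.
    change (RtoC (bin 0 (INR N))) with C1; ring.
Qed.

(** The factors [A - z] are peeled off one at a time. The sequence [(A - z) Y] solves a system of
    the same kind with a shorter list; once it is known, [Y (N + 1) - z Y N] is known and each
    coordinate satisfies a scalar recurrence. *)
Lemma interp_seq_system n (A : mat n) l (Y : nat -> Fin.t n -> C) :
  (forall z, In z l -> exists w, L w /\ cexp w = Cpow z m) ->
  (forall i, E0 (fun N => Y (S N) i - fsum n (fun j => A i j * Y N j))%cx) ->
  (forall i, E0 (fun N => fold_left (shifted_mul A) l (Y N) i)) ->
  forall i, E0 (fun N => Y N i).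
Proof.
  revert Y; induction l as [|z l IH]; intros Y Hl HY Hf; [exact Hf|]; intros i.
  pose proof interp_seq_alg as HV.
  assert (HY' : forall i, E0 (fun N => shifted_mul A (Y N) z i)).
  { apply (IH (fun N => shifted_mul A (Y N) z)); [intros; apply Hl; right; trivial | | exact Hf].
    intros k; eapply alg_ext.
    - apply (alg_add _ HV).
      + apply (fsum_closed nat _ n (fun N j => A k j * (Y (S N) j - fsum n (fun i => A j i * Y N i)))%cx HV).
        intros j; apply (alg_mul _ HV _ _ (alg_const _ HV (A k j)) (HY j)).
      + apply (alg_mul _ HV _ _ (alg_const _ HV (- z)%cx) (HY k)).
    - intros N; cbn beta; unfold shifted_mul.
      rewrite (fsum_ext n (fun j => A k j * (Y (S N) j - fsum n (fun i => A j i * Y N i)))%cx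
        (fun j => A k j * Y (S N) j + ((- C1) * (A k j * (fsum n (fun i => A j i * Y N i) - z * Y N j))
                   + A k j * Y N j * (- z)))%cx) by (intros; ring).
      rewrite !fsum_add, fsum_mul_r.
      rewrite (fsum_ext n (fun j => - C1 * (A k j * (fsum n (fun i => A j i * Y N i) - z * Y N j)))%cx
        (fun j => A k j * (fsum n (fun i => A j i * Y N i) - z * Y N j) * (- C1))%cx) by (intros; ring).
      rewrite fsum_mul_r; ring. }
  destruct (Hl z (or_introl eq_refl)) as (w & Hw & Ew).
  apply (interp_seq_resolvent _ z w Hw Ew).
  eapply alg_ext; [apply (alg_add _ HV _ _ (HY i) (HY' i))|].
  intros N; cbn beta; unfold shifted_mul; ring.
Qed.
End Interpolation.

(** * Linear parts and the Jacobian of an automorphism *)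

Lemma smul_degree1 n (f g : series n) a :
  f (midx0 n) = C0 -> g (midx0 n) = C0 -> (deg a <= 1)%nat -> smul f g a = C0.
Proof.
  intros Hf Hg Ha; unfold smul; apply boxsum_zero; intros b Hb.
  pose proof (deg_msub n a b Hb) as Hd.
  destruct (Nat.eq_dec (deg b) 0) as [E|E].
  - apply deg_eq_0 in E; subst b; rewrite Hf; ring.
  - assert (E' : deg (msub a b) = O) by lia; apply deg_eq_0 in E'.
    unfold msub in E'; rewrite E', Hg; ring.
Qed.

Lemma evar_inj n (i j : Fin.t n) : evar i = evar j -> i = j.
Proof.
  intros E; apply (f_equal (fun a => a i)) in E; unfold evar in E.
  destruct (Fin.eq_dec i i); [|congruence]; destruct Fin.eq_dec; [auto | discriminate].
Qed.

Lemma X_evar n (i j : Fin.t n) : X i (evar j) = if Fin.eq_dec i j then C1 else C0.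
Proof.
  destruct Fin.eq_dec as [->|Hne]; [apply mono_same | apply mono_other].
  intros E; apply evar_inj in E; auto.
Qed.

Lemma sdiv_midx0 n i (f : series n) : sdiv i f (midx0 n) = f (evar i).
Proof.
  unfold sdiv; rewrite deg_midx0; change (midx0 n i) with O.
  replace (madd (midx0 n) (evar i)) with (evar i) by reflexivity.
  simpl; replace (1 / 1)%R with 1 by field; change (RtoC 1) with C1; ring.
Qed.

Definition jacobian {n} (Phi : series n -> series n) : mat n := fun i j => Phi (X i) (evar j).

Definition linpart {n} (Phi : series n -> series n) (i : Fin.t n) : series n :=
  ssum n (fun j => sscal (jacobian Phi i j) (X j)).
Definition nonlin {n} (Phi : series n -> series n) (i : Fin.t n) : series n :=
  sadd (Phi (X i)) (sscal (- C1)%cx (linpart Phi i)).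

Section Jacobian.
Variable n : nat.
Implicit Types Phi Psi : series n -> series n.

Lemma aut_X_split Phi Psi i a :
  IsAut Psi ->
  Psi (Phi (X i)) a = (fsum n (fun j => jacobian Phi i j * Psi (X j) a) + Psi (nonlin Phi i) a)%cx.
Proof.
  intros H; replace (Phi (X i)) with (sadd (linpart Phi i) (nonlin Phi i)).
  - unfold linpart; rewrite aut_add, aut_ssum by trivial; unfold sadd, ssum; f_equal.
    apply fsum_ext; intros j; rewrite aut_scal; trivial.
  - extensionality b; unfold nonlin, sadd, sscal; ring.
Qed.

Lemma nonlin_midx0 Phi i : IsAut Phi -> nonlin Phi i (midx0 n) = C0.
Proof.
  intros H; unfold nonlin, linpart, sadd, sscal, ssum.
  rewrite aut_maximal, fsum_zero by (trivial || apply X_midx0 || (intros; rewrite X_midx0; ring)).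
  ring.
Qed.

Lemma nonlin_evar Phi i j : nonlin Phi i (evar j) = C0.
Proof.
  unfold nonlin, linpart, sadd, sscal, ssum; rewrite (fsum_single n _ j).
  - rewrite X_evar; destruct Fin.eq_dec; [unfold jacobian; ring | congruence].
  - intros k Hk; rewrite X_evar; destruct Fin.eq_dec; [congruence | ring].
Qed.

(** Compare linear terms in [Psi (Phi x_i) = x_i]. The remainder [nonlin] starts in degree two, and
    [Psi] keeps it there, because it becomes a sum of products of two series without constant
    term. *)
Lemma jacobian_inverse Phi Psi :
  IsAut Phi -> IsAut Psi -> (forall f, Psi (Phi f) = f) -> mmul (jacobian Phi) (jacobian Psi) = mid.
Proof.
  intros HP HQ HK; extensionality i; extensionality k.
  pose proof (aut_X_split Phi Psi i (evar k) HQ) as E.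
  rewrite HK, X_evar, (aut_euler n Psi (nonlin Phi i)), nonlin_midx0 in E by trivial.
  rewrite (fsum_zero n (fun j => smul _ _ _)) in E.
  2: { intros j; apply smul_degree1.
       - apply aut_maximal; [trivial | apply X_midx0].
       - apply aut_maximal; [trivial | rewrite sdiv_midx0; apply nonlin_evar].
       - rewrite deg_evar; trivial. }
  unfold mmul, mid; rewrite E; unfold jacobian; ring.
Qed.
End Jacobian.

(** * The integer powers of a single automorphism *)

Section Iterates.
Variables (n : nat) (r : Z -> series n -> series n).
Hypothesis Hr : forall k, IsAut (r k).
Hypothesis Hadd : forall k k' f, r (k + k')%Z f = r k (r k' f).

Lemma iterate_0 f : r 0 f = f.
Proof. apply (aut_inj n (r 0%Z)); [apply Hr|]; rewrite <- Hadd; reflexivity. Qed.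

(** Induction on the degree: in degree [d + 1] the coefficients of the iterates of the variables
    solve a linear system with the Jacobian as matrix and a right-hand side built from degrees at
    most [d]. General series follow from the variables. *)
Lemma iterates_interpolated :
  exists m L, (0 < m)%nat /\ exp_lattice L /\
    forall f a, interp_seq L m (fun N => r (Z.of_nat N) f a).
Proof.
  assert (HK : forall f, r (-1) (r 1 f) = f)
    by (intros f; rewrite <- Hadd; apply iterate_0).
  destruct (Spectrum.annihilating_eigenvalues n (jacobian (r 1)) (jacobian (r (-1))))
    as (l & Hl & Hann); [apply jacobian_inverse; auto|].
  destruct (nonresonant_logarithms l Hl) as (m & L & Hm & HL & Hlog).
  exists m, L; split; [trivial|]; split; [trivial|].
  pose proof (interp_seq_alg L m HL) as HV.
  set (H := fun (N : nat) => r (Z.of_nat N)).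
  assert (HH : forall N, IsAut (H N)) by (intros; apply Hr).
  assert (HX : forall d i a, (deg a <= d)%nat -> interp_seq L m (fun N => H N (X i) a)).
  { induction d as [|d IH]; intros i a Ha.
    - replace a with (midx0 n) by (symmetry; apply deg_eq_0; lia).
      eapply alg_ext; [apply (alg_const _ HV C0)|].
      intros N; apply aut_maximal; [apply HH | apply X_midx0].
    - destruct (Nat.eq_dec (deg a) (S d)) as [Ea|]; [|apply IH; lia].
      revert i; apply (interp_seq_system L m HL n (jacobian (r 1)) l (fun N i => H N (X i) a) Hlog).
      (* The right-hand side is the image of [nonlin], which starts in degree two. Both factors in
         its Euler decomposition therefore lack a constant term, and only degrees at most [d]
         occur. *)
      + intros i; apply (alg_ext _ _ (fun N => H N (nonlin (r 1%Z) i) a)).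
        * eapply alg_ext; [|intros N; apply (aut_euler n (H N)); trivial].
          apply (alg_add _ HV); [apply (alg_const _ HV)|].
          apply (fsum_closed nat _ n
            (fun N j => smul (H N (X j)) (H N (sdiv j (nonlin (r 1%Z) i))) a) HV); intros j.
          apply (smul_closed_both nat _ n (fun N => H N (X j))
                   (fun N => H N (sdiv j (nonlin (r 1%Z) i))) a HV).
          -- intros N; apply aut_maximal; [apply HH | apply X_midx0].
          -- intros N; apply aut_maximal; [apply HH | rewrite sdiv_midx0; apply nonlin_evar].
          -- intros b Hb; apply IH; lia.
          -- intros b Hb.
             apply (aut_family_closed n nat _ H d HV HH IH b (fun _ => sdiv j (nonlin (r 1%Z) i)));
               [lia | intros; apply (alg_const _ HV)].
        (* The extra step is the inner one, so that the coefficients of the system do not depend on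
           [N]. *)
        * intros N; unfold H at 1; rewrite Nat2Z.inj_succ; unfold Z.succ; rewrite Hadd.
          change (r (Z.of_nat N)) with (H N); rewrite (aut_X_split n (r 1%Z) (H N) i a (HH N)); ring.
      + intros i; eapply alg_ext; [apply (alg_const _ HV C0)|]; intros N; apply Hann. }
  intros f a.
  apply (aut_family_closed n nat _ H (deg a) HV HH (HX (deg a)) a (fun _ => f) (le_n _)).
  intros b; apply (alg_const _ HV).
Qed.

(** Each coefficient of [r (m N) f] is extended separately from natural to real times. Every
    property of the flow is an identity between exponential polynomials with exponents in [L], valid
    at natural times and hence everywhere. *)
Lemma flow_of_iterates :
  exists (m : nat) (phi : R -> series n -> series n), (0 < m)%nat /\
    (forall t, IsAut (phi t)) /\
    (forall s t f, phi (s + t) f = phi s (phi t f)) /\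
    (forall t0 f a, cont_at (near_R t0) t0 (fun t => phi t f a)) /\
    (forall h : series n -> series n, IsAut h -> (forall k f, h (r k f) = r k (h f)) ->
       forall t f, h (phi t f) = phi t (h f)) /\
    (forall k f, phi (IZR k) f = r (Z.of_nat m * k)%Z f).
Proof.
  destruct iterates_interpolated as (m & L & Hm & HL & Hint).
  assert (Hex : forall fa : series n * midx n, exists u, exp_poly L u /\
            forall N, r (Z.of_nat (m * N)) (fst fa) (snd fa) = u (INR N)).
  { intros [f a]; destruct (Hint f a O) as (u & Hu & Eu); exists u; split; [trivial|].
    intros N; rewrite <- Eu, Nat.add_0_r; trivial. }
  destruct (choice _ Hex) as [u Hu].
  set (phi := fun t f a => u (f, a) t).
  assert (HE : forall f a, exp_poly L (fun t => phi t f a)) by (intros f a; apply (Hu (f, a))).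
  assert (HN : forall N f, phi (INR N) f = r (Z.of_nat (m * N)) f).
  { intros N f; extensionality a; symmetry; apply (Hu (f, a)). }
  assert (Hid : forall u v, exp_poly L u -> exp_poly L v ->
            (forall N, u (INR N) = v (INR N)) -> forall t, u t = v t).
  { intros; apply (exp_poly_unique L); trivial. }
  assert (HV : alg_closed (exp_poly L)).
  { constructor; [apply exp_poly_const | apply exp_poly_add | apply exp_poly_mul]; trivial. }
  assert (Haut : forall (h : series n -> series n) F, IsAut h -> (forall b, exp_poly L (fun t => F t b)) ->
            forall a, exp_poly L (fun t => h (F t) a)).
  { intros h F Hh HF a.
    apply (aut_family_closed n R _ (fun _ => h) (deg a) HV (fun _ => Hh)); trivial.
    intros; apply (alg_const _ HV). }
  assert (Hphi_add : forall t f g, phi t (sadd f g) = sadd (phi t f) (phi t g)).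
  { intros t f g; extensionality a; revert t; apply Hid; [apply HE | |].
    - apply (alg_add _ HV); apply HE.
    - intros N; rewrite HN, aut_add by trivial; unfold sadd; rewrite !HN; trivial. }
  assert (Hphi_scal : forall t c f, phi t (sscal c f) = sscal c (phi t f)).
  { intros t c f; extensionality a; revert t; apply Hid; [apply HE | |].
    - apply (alg_mul _ HV); [apply (alg_const _ HV) | apply HE].
    - intros N; rewrite HN, aut_scal by trivial; unfold sscal; rewrite !HN; trivial. }
  assert (Hphi_mul : forall t f g, phi t (smul f g) = smul (phi t f) (phi t g)).
  { intros t f g; extensionality a; revert t; apply Hid; [apply HE | |].
    - apply (boxsum_closed R _ n a (fun t b => phi t f b * phi t g (msub a b))%cx);
        [apply (alg_add _ HV)|]; intros b _; apply (alg_mul _ HV); apply HE.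
    - intros N; rewrite !HN, aut_mul by trivial; trivial. }
  assert (Hphi_one : forall t, phi t sone = sone).
  { intros t; extensionality a; revert t; apply Hid; [apply HE | apply (alg_const _ HV) |].
    intros N; rewrite HN, aut_one by trivial; trivial. }
  assert (Hphi_0 : forall t f, phi t f (midx0 n) = f (midx0 n)).
  { intros t f; revert t; apply Hid; [apply HE | apply (alg_const _ HV) |].
    intros N; rewrite HN, aut_constant_term by trivial; trivial. }
  (* The group law is extended in one variable at a time: first one time is natural and the other
     real, then both are real. *)
  assert (Hshift : forall N s f, phi (s + INR N) f = r (Z.of_nat (m * N)) (phi s f)).
  { intros N s f; extensionality a; revert s; apply Hid.
    - apply (exp_poly_shift L HL (INR N) (fun t => phi t f a)), HE.
    - apply Haut; auto.
    - intros M; rewrite <- plus_INR, !HN, <- Hadd, <- Nat2Z.inj_add.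
      rewrite <- Nat.mul_add_distr_l, (Nat.add_comm N M); trivial. }
  assert (Hgrp : forall s t f, phi (s + t) f = phi s (phi t f)).
  { intros s t f; extensionality a; revert s; apply Hid; [| apply HE |].
    - apply (exp_poly_shift L HL t (fun t => phi t f a)), HE.
    - intros N; rewrite Rplus_comm, Hshift, HN; trivial. }
  assert (Hzero : forall f, phi 0 f = f).
  { intros f; change 0 with (INR 0); rewrite HN, Nat.mul_0_r; apply iterate_0. }
  assert (Hinv : forall t f, phi (- t) (phi t f) = f).
  { intros t f; rewrite <- Hgrp, Rplus_opp_l; apply Hzero. }
  exists m, phi; split; [trivial|].
  split; [|split; [trivial|split; [|split]]].
  - intros t; split; [apply Hphi_add|]; split; [apply Hphi_scal|].
    split; [apply Hphi_mul|]; split; [apply Hphi_one|]; split.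
    + exists (phi (- t)); split; [apply Hinv|].
      intros f; rewrite <- (Ropp_involutive t) at 1; apply Hinv.
    + intros f; rewrite Hphi_0; tauto.
  - intros t0 f a; apply (exp_poly_cont L), HE.
  - intros h Hh Hc t f; extensionality a; revert t; apply Hid.
    + apply Haut; auto.
    + apply HE.
    + intros N; rewrite !HN, Hc; trivial.
  - assert (Hpos : forall N f, phi (IZR (Z.of_nat N)) f = r (Z.of_nat m * Z.of_nat N)%Z f).
    { intros N f; rewrite <- INR_IZR_INZ, HN, Nat2Z.inj_mul; trivial. }
    intros k f; destruct (Z_le_gt_dec 0 k) as [Hk|Hk].
    + rewrite <- (Z2Nat.id k Hk); apply Hpos.
    (* For negative [k] both sides become [f] under the injective power of exponent [- m k]. *)
    + apply (aut_inj n (r (Z.of_nat m * Z.of_nat (Z.to_nat (- k)))%Z)); [trivial|].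
      rewrite <- Hpos, <- Hgrp, <- plus_IZR, <- Hadd, Z2Nat.id by lia.
      replace (- k + k)%Z with 0%Z by ring; rewrite Hzero.
      replace (Z.of_nat m * - k + Z.of_nat m * k)%Z with 0%Z by ring; symmetry; apply iterate_0.
Qed.
End Iterates.

(** * Flows in several real parameters *)

Lemma aut_id n : IsAut (fun f : series n => f).
Proof. repeat split; trivial; exists (fun f => f); auto. Qed.

Lemma aut_comp n (Phi Psi : series n -> series n) :
  IsAut Phi -> IsAut Psi -> IsAut (fun f => Phi (Psi f)).
Proof.
  intros (A1 & A2 & A3 & A4 & (I & A5 & A6) & A7) (B1 & B2 & B3 & B4 & (J & B5 & B6) & B7).
  split; [intros; rewrite B1, A1; trivial|].
  split; [intros; rewrite B2, A2; trivial|].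
  split; [intros; rewrite B3, A3; trivial|].
  split; [rewrite B4; trivial|].
  split; [exists (fun f => J (I f)); split; intros f; [rewrite A5 | rewrite B6]; trivial|].
  intros f; rewrite B7; apply A7.
Qed.

Lemma rcont_comp T (near : R -> T -> Prop) x0 (u : T -> R) v :
  rcont_at near x0 u -> continuity_pt v (u x0) -> rcont_at near x0 (fun x => v (u x)).
Proof.
  intros Hu Hv eps He; destruct (rcont_at_continuity_pt v _ Hv eps He) as (d & Hd & Hd').
  destruct (Hu d Hd) as (d2 & Hd2 & Hd2').
  exists d2; split; [trivial|]; intros x Hx; apply Hd', Hd2'; trivial.
Qed.

Lemma rcont_coord q (s0 : Fin.t q -> R) i : rcont_at (near_V s0) s0 (fun s => s i).
Proof. intros eps He; exists eps; split; auto. Qed.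

Definition zcons {m} (z : Z) (k : Fin.t m -> Z) : Fin.t (S m) -> Z :=
  fun i => Fin.caseS' i (fun _ => Z) z k.

(** Induction on the rank: the flow of the first generator is composed with the multiflow of the
    others. The commutation clause belongs to the induction because it makes these two commute. *)
Lemma multiflow_of_lattice n p (r : (Fin.t p -> Z) -> series n -> series n) :
  (forall k, IsAut (r k)) ->
  (forall k k' f, r (zadd k k') f = r k (r k' f)) ->
  exists (m : nat) (Phi : (Fin.t p -> R) -> series n -> series n), (0 < m)%nat /\
    (forall s, IsAut (Phi s)) /\
    (forall s t f, Phi (radd s t) f = Phi s (Phi t f)) /\
    (forall s0 f a, cont_at (near_V s0) s0 (fun s => Phi s f a)) /\
    (forall h : series n -> series n, IsAut h -> (forall k f, h (r k f) = r k (h f)) ->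
       forall s f, h (Phi s f) = Phi s (h f)) /\
    (forall k f, Phi (fun i => IZR (k i)) f = r (fun i => Z.of_nat m * k i)%Z f).
Proof.
  revert r; induction p as [|p IH]; intros r Hr Hadd.
  - assert (Hone : forall k k' : Fin.t 0 -> Z, k = k')
      by (intros; extensionality i; apply (Fin.case0 (fun i => _) i)).
    assert (Hid : forall k f, r k f = f).
    { intros k f; apply (aut_inj n (r k)); [trivial|].
      rewrite <- Hadd; f_equal; apply Hone. }
    exists 1%nat, (fun _ f => f); repeat apply conj; intros; auto using aut_id.
    apply (alg_const _ (cont_at_alg _ _ _ (near_V_antitone 0 s0))).
  - destruct (flow_of_iterates n (fun z => r (zcons z (fun _ => 0%Z))))
      as (m1 & phi & Hm1 & Hphi & Hphig & Hphic & Hphih & Hphik).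
    { intros; apply Hr. }
    { intros k k' f; rewrite <- Hadd; f_equal; extensionality i; revert i; apply fin_case; reflexivity. }
    destruct (IH (fun k => r (zcons 0 k))) as (m2 & Phi & Hm2 & HPhi & HPhig & HPhic & HPhih & HPhik).
    { intros; apply Hr. }
    { intros k k' f; rewrite <- Hadd; f_equal; extensionality i; revert i; apply fin_case; reflexivity. }
    assert (Hcomm : forall k k' f, r k (r k' f) = r k' (r k f)).
    { intros k k' f; rewrite <- !Hadd; f_equal; extensionality i; unfold zadd; ring. }
    (* The exponents [m1] and [m2] may differ; each time is rescaled by the other exponent, so that
       both flows interpolate powers with the common exponent [m1 m2]. *)
    set (S1 := fun s : Fin.t (S p) -> R => INR m2 * s Fin.F1).
    set (S2 := fun (s : Fin.t (S p) -> R) i => INR m1 * s (Fin.FS i)).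
    exists (m1 * m2)%nat, (fun s f => phi (S1 s) (Phi (S2 s) f)).
    split; [nia|]; split; [intros; apply (aut_comp n (phi _)); trivial|]; split; [|split; [|split]].
    + intros s t f.
      replace (S1 (radd s t)) with (S1 s + S1 t) by (unfold S1, radd; ring).
      replace (S2 (radd s t)) with (radd (S2 s) (S2 t))
        by (extensionality i; unfold S2, radd; ring).
      rewrite Hphig, HPhig; f_equal.
      apply (HPhih (phi (S1 t))); [trivial|]; intros k g.
      symmetry; apply Hphih; trivial.
    + intros s0 f a.
      pose proof (cont_at_alg _ _ s0 (near_V_antitone (S p) s0)) as HV.
      assert (HS1 : rcont_at (near_V s0) s0 S1).
      { apply (rcont_comp _ _ _ (fun s => s Fin.F1) (fun x => INR m2 * x) (rcont_coord _ s0 _)); reg. }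
      assert (HS2 : forall i, rcont_at (near_V s0) s0 (fun s => S2 s i)).
      { intros i.
        apply (rcont_comp _ _ _ (fun s => s (Fin.FS i)) (fun x => INR m1 * x) (rcont_coord _ s0 _)); reg. }
      apply (aut_family_closed n _ _ (fun s => phi (S1 s)) (deg a) HV
               (fun s => Hphi (S1 s))); [| lia |].
      * intros i b _; apply (cont_comp_R _ _ s0 S1 (fun t => phi t (X i) b)); trivial.
      * intros b; apply (cont_comp_V _ _ s0 p S2 (fun t => Phi t f b)); trivial.
        apply near_V_antitone.
    + intros h Hh Hc s f; rewrite Hphih, HPhih; auto.
    + intros k f.
      assert (E1 : S1 (fun i => IZR (k i)) = IZR (Z.of_nat m2 * k Fin.F1))
        by (unfold S1; rewrite mult_IZR, <- INR_IZR_INZ; trivial).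
      assert (E2 : S2 (fun i => IZR (k i)) = fun i => IZR (Z.of_nat m1 * k (Fin.FS i)))
        by (extensionality i; unfold S2; rewrite mult_IZR, <- INR_IZR_INZ; trivial).
      rewrite E1, E2, Hphik.
      rewrite (HPhik (fun i => Z.of_nat m1 * k (Fin.FS i))%Z), <- Hadd; f_equal.
      extensionality i; revert i; apply fin_case; [|intros i]; unfold zadd; simpl; lia.
Qed.

(** * Roots of unity *)

Lemma Cnorm_opp z : Cnorm (- z)%cx = Cnorm z.
Proof. unfold Cnorm, Copp; f_equal; simpl; ring. Qed.

Lemma Cnorm_pos z : z <> C0 -> 0 < Cnorm z.
Proof.
  intros Hz; destruct (Cnorm_ge_0 z) as [|E]; [trivial|].
  symmetry in E; apply Cnorm_eq_0 in E; tauto.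
Qed.

Lemma cexp_eq_C1 z : cexp z = C1 -> fst z = 0 /\ exists k, snd z = 2 * PI * IZR k.
Proof.
  destruct z as [x y]; unfold cexp, C1; simpl; intros H; injection H as H1 H2.
  pose proof (exp_pos x) as Hx.
  assert (Hs : sin y = 0) by nra.
  pose proof (sin2_cos2 y) as Hsc; unfold Rsqr in Hsc; rewrite Hs in Hsc.
  assert (Hc : cos y = 1) by nra.
  split.
  - rewrite Hc, Rmult_1_r in H1; rewrite <- (ln_exp x), H1; apply ln_1.
  (* Passing to the half angle turns [cos y = 1] into [sin (y / 2) = 0]. *)
  - replace y with (2 * (y / 2)) in Hc by field; rewrite cos_2a_sin in Hc.
    destruct (sin_eq_0_0 (y / 2)) as [k Hk]; [nra|]; exists k; lra.
Qed.

Definition unity_root (m : nat) (k : Z) : C := cexp (0, 2 * PI * IZR k / INR m).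

Section RootsOfUnity.
Variable m : nat.
Hypothesis Hm : (0 < m)%nat.

Lemma INR_m_neq_0 : INR m <> 0.
Proof. apply not_0_INR; lia. Qed.

Lemma unity_root_add k k' : unity_root m (k + k') = (unity_root m k * unity_root m k')%cx.
Proof.
  unfold unity_root; rewrite <- cexp_add, plus_IZR; f_equal.
  unfold Cadd; simpl; f_equal; field; apply INR_m_neq_0.
Qed.

Lemma unity_root_pow k : Cpow (unity_root m k) m = C1.
Proof.
  unfold unity_root; rewrite <- cexp_INR; unfold cexp, Cmul, RtoC, C1; simpl.
  pose proof INR_m_neq_0.
  replace (INR m * 0 - 0 * (2 * PI * IZR k / INR m)) with 0 by ring.
  replace (INR m * (2 * PI * IZR k / INR m) + 0 * 0) with (2 * (IZR k * PI)) by (field; trivial).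
  assert (Hs : sin (IZR k * PI) = 0) by (apply sin_eq_0_1; exists k; trivial).
  rewrite exp_0, sin_2a, cos_2a_sin, Hs; f_equal; ring.
Qed.

Lemma unity_root_inj k k' :
  unity_root m k = unity_root m k' -> exists c, k = (k' + Z.of_nat m * c)%Z.
Proof.
  intros E.
  assert (H : unity_root m (k - k') = C1).
  { replace C1 with (unity_root m (k' - k')).
    - unfold Z.sub; rewrite !unity_root_add, E; trivial.
    - rewrite Z.sub_diag; unfold unity_root; rewrite <- cexp_0; f_equal; unfold C0; f_equal.
      unfold Rdiv; ring. }
  apply cexp_eq_C1 in H; destruct H as [_ [c Hc]]; simpl in Hc; exists c.
  pose proof PI_RGT_0; pose proof INR_m_neq_0.
  apply eq_IZR; rewrite plus_IZR, mult_IZR, <- INR_IZR_INZ.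
  rewrite minus_IZR in Hc.
  assert (Hc' : 2 * PI * (IZR k - IZR k') = 2 * PI * (INR m * IZR c)).
  { transitivity (2 * PI * (IZR k - IZR k') / INR m * INR m); [field; trivial|].
    rewrite Hc; ring. }
  apply Rmult_eq_reg_l in Hc'; lra.
Qed.

Lemma unity_root_surj z : Cpow z m = C1 -> exists k, z = unity_root m k.
Proof.
  intros Hz.
  assert (Hz0 : z <> C0).
  { intros ->; destruct m as [|m']; [lia|]; apply C1_neq_C0; rewrite <- Hz; simpl; ring. }
  destruct (cexp_surj z Hz0) as [[x y] <-]; rewrite <- cexp_INR in Hz.
  apply cexp_eq_C1 in Hz; destruct Hz as [H1 [k Hk]]; exists k; unfold unity_root.
  pose proof INR_m_neq_0 as Hm0; unfold Cmul, RtoC in *; simpl in *.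
  f_equal; f_equal.
  - apply Rmult_eq_reg_l with (INR m); [lra | trivial].
  - apply Rmult_eq_reg_l with (INR m); trivial; field_simplify; trivial; lra.
Qed.

(* Near [z0] the cofactor of [z - z0] in [z^m - z0^m] stays close to [m z0^(m-1)]. *)
Lemma unity_root_isolated z0 :
  Cpow z0 m = C1 ->
  exists d, d > 0 /\ forall z, Cpow z m = C1 -> Cnorm (z - z0)%cx < d -> z = z0.
Proof.
  intros Hz0.
  set (Q := fix Q (k : nat) (z : C) : C :=
    match k with O => C0 | S k' => (z * Q k' z + Cpow z0 k')%cx end).
  assert (HQ : forall k z, (Cpow z k - Cpow z0 k = (z - z0) * Q k z)%cx).
  { induction k as [|k IH]; intros z; cbn [Cpow Q]; [ring|].
    transitivity (z * (Cpow z k - Cpow z0 k) + (z - z0) * Cpow z0 k)%cx; [ring | rewrite IH; ring]. }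
  assert (HQ0 : forall k, (z0 * Q k z0 = RtoC (INR k) * Cpow z0 k)%cx).
  { induction k as [|k IH]; cbn [Cpow Q]; [change (RtoC (INR 0)) with C0; ring|].
    rewrite IH, S_INR, RtoC_add; change (RtoC 1) with C1; ring. }
  assert (Hne : Q m z0 <> C0).
  { intros E; specialize (HQ0 m); rewrite E, Hz0 in HQ0.
    apply INR_m_neq_0, RtoC_inj; change (RtoC 0) with C0.
    transitivity (RtoC (INR m) * C1)%cx; [ring | rewrite <- HQ0; ring]. }
  pose proof (Cnorm_pos _ Hne) as Hpos.
  set (near := fun (d : R) (z : C) => Cnorm (z - z0)%cx < d).
  assert (Hn : antitone near) by (intros d d' z ? ?; unfold near in *; lra).
  pose proof (cont_at_alg C near z0 Hn) as HV.
  assert (Hcont : forall k, cont_at near z0 (Q k)).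
  { induction k as [|k IH]; cbn [Q]; [apply (alg_const _ HV)|].
    apply (alg_add _ HV (fun z => z * Q k z)%cx); [|apply (alg_const _ HV)].
    apply (alg_mul _ HV (fun z => z)); [|trivial].
    intros eps He; exists eps; split; trivial. }
  destruct (Hcont m _ Hpos) as (d & Hd & Hd'); exists d; split; [trivial|]; intros z Hz Hzd.
  specialize (Hd' z Hzd); specialize (HQ m z); rewrite Hz, Hz0 in HQ.
  destruct (Cmul_integral (z - z0)%cx (Q m z)) as [E|E].
  - rewrite <- HQ; ring.
  - transitivity (z0 + (z - z0))%cx; [ring | rewrite E; ring].
  - exfalso; rewrite E in Hd'.
    replace (C0 - Q m z0)%cx with (- Q m z0)%cx in Hd' by ring.
    rewrite Cnorm_opp in Hd'; lra.
Qed.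
End RootsOfUnity.

(** * Diagonal groups *)

(** A product of copies of [GL_1(C)], with the group [mu_m] of roots of unity at the positions in
    [U]. *)
Definition diag_group (N m : nat) (U : Fin.t N -> Prop) (A : mat N) : Prop :=
  (forall i j, i <> j -> A i j = C0) /\ (forall i, A i i <> C0) /\
  (forall i, U i -> Cpow (A i i) m = C1).

Lemma mmul_diag N (A B : mat N) i j :
  (forall i j, i <> j -> A i j = C0) -> mmul A B i j = (A i i * B i j)%cx.
Proof.
  intros HA; unfold mmul; rewrite (fsum_single N _ i); [trivial|].
  intros l Hl; rewrite HA by auto; ring.
Qed.

Lemma fprod_one n f : (forall i, f i = C1) -> fprod n f = C1.
Proof.
  induction n as [|n IH]; intros H; simpl; [trivial|]; rewrite H, IH by auto; ring.
Qed.

Lemma fprod_single n f i : (forall j, j <> i -> f j = C1) -> fprod n f = f i.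
Proof.
  revert f; induction i as [n|n i IH]; intros f H; simpl.
  - rewrite fprod_one; [ring|]; intros j; apply H; discriminate.
  - rewrite (IH (fun j => f (Fin.FS j))), H; [ring | discriminate |].
    intros j Hj; apply H; intros E; apply Fin.FS_inj in E; auto.
Qed.

(** The exponents of the monomial [a_{i0 j0}^k]; for [k = 0] this is the constant 1. *)
Definition entry_power {N} (i0 j0 : Fin.t N) (k : nat) : Fin.t N -> Fin.t N -> nat :=
  fun i j => if Fin.eq_dec i0 i then if Fin.eq_dec j0 j then k else O else O.

Lemma entry_power_eval N (A : mat N) i0 j0 k :
  fprod N (fun i => fprod N (fun j => Cpow (A i j) (entry_power i0 j0 k i j))) = Cpow (A i0 j0) k.
Proof.
  unfold entry_power; rewrite (fprod_single N _ i0).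
  - rewrite (fprod_single N _ j0).
    + do 2 (destruct Fin.eq_dec; [|congruence]); trivial.
    + intros j Hj; destruct Fin.eq_dec; [destruct Fin.eq_dec; [congruence|]|]; trivial.
  - intros i Hi; apply fprod_one; intros j; destruct Fin.eq_dec; [congruence | trivial].
Qed.

Lemma diag_group_algebraic N m U : AbelianLinAlgGroup N (diag_group N m U).
Proof.
  assert (Hinv : forall A, diag_group N m U A ->
    exists B, diag_group N m U B /\ mmul A B = mid /\ mmul B A = mid).
  { intros A (HA1 & HA2 & HA3); set (B := fun i j => if Fin.eq_dec i j then Cinv (A i i) else C0).
    assert (HB : forall i j, i <> j -> B i j = C0).
    { intros i j Hij; unfold B; destruct Fin.eq_dec; congruence. }
    assert (HBi : forall i, B i i = Cinv (A i i)).
    { intros i; unfold B; destruct Fin.eq_dec; congruence. }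
    exists B; repeat split; trivial.
    - intros i E; rewrite HBi in E; apply C1_neq_C0.
      transitivity (A i i * Cinv (A i i))%cx; [field; trivial | rewrite E; ring].
    - intros i Hi; rewrite HBi.
      transitivity (Cpow (A i i) m * Cpow (Cinv (A i i)) m)%cx; [rewrite HA3 by trivial; ring|].
      rewrite <- Cpow_mul; replace (A i i * Cinv (A i i))%cx with C1 by (field; trivial).
      apply Cpow_one.
    - extensionality i; extensionality j; rewrite mmul_diag by trivial.
      unfold mid; destruct Fin.eq_dec as [->|Hij]; [rewrite HBi; field; trivial|].
      rewrite HB by trivial; ring.
    - extensionality i; extensionality j; rewrite mmul_diag by trivial.
      unfold mid; destruct Fin.eq_dec as [->|Hij]; [rewrite HBi; field; trivial|].
      rewrite HA1 by trivial; ring. }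
  split; [|split; [|split; [|split]]].
  (* The equations are [a_ij = 0] off the diagonal and [a_ii^m - 1 = 0] for [i] in [U]. *)
  - exists (fun P => (exists i j, i <> j /\ P = (C1, entry_power i j 1) :: nil) \/
      (exists i, U i /\ P = (C1, entry_power i i m) :: ((- C1)%cx, entry_power i i 0) :: nil)).
    intros A; split.
    + intros HA; destruct (Hinv A HA) as (B & _ & HB); split; [exists B; trivial|].
      destruct HA as (HA1 & HA2 & HA3).
      intros P [(i & j & Hij & ->)|(i & Hi & ->)]; unfold meval; cbn [fold_right fst snd];
        rewrite !entry_power_eval; cbn [Cpow].
      * rewrite HA1 by trivial; ring.
      * rewrite HA3 by trivial; ring.
    + intros [[B [HB _]] HS].
      assert (HA1 : forall i j, i <> j -> A i j = C0).
      { intros i j Hij; specialize (HS _ (or_introl (ex_intro _ i (ex_intro _ j (conj Hij eq_refl))))).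
        unfold meval in HS; cbn [fold_right fst snd] in HS; rewrite entry_power_eval in HS.
        rewrite <- HS; cbn [Cpow]; ring. }
      repeat split; trivial.
      * intros i E; apply C1_neq_C0.
        assert (E' : mmul A B i i = C1)
          by (rewrite HB; unfold mid; destruct Fin.eq_dec; congruence).
        rewrite mmul_diag, E in E' by trivial; rewrite <- E'; ring.
      * intros i Hi; specialize (HS _ (or_intror (ex_intro _ i (conj Hi eq_refl)))).
        unfold meval in HS; cbn [fold_right fst snd] in HS; rewrite !entry_power_eval in HS.
        cbn [Cpow] in HS.
        transitivity (C1 * Cpow (A i i) m + (- C1 * C1 + C0) + C1)%cx; [ring | rewrite HS; ring].
  - repeat split; unfold mid; intros.
    + destruct Fin.eq_dec; congruence.
    + destruct Fin.eq_dec; [apply C1_neq_C0 | congruence].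
    + destruct Fin.eq_dec; [apply Cpow_one | congruence].
  - intros A B (HA1 & HA2 & HA3) (HB1 & HB2 & HB3); repeat split; intros;
      rewrite mmul_diag by trivial.
    + rewrite HB1 by trivial; ring.
    + intros E; apply Cmul_integral in E; destruct E as [E|E]; [apply (HA2 i) | apply (HB2 i)]; trivial.
    + rewrite Cpow_mul, HA3, HB3 by trivial; ring.
  - exact Hinv.
  - intros A B (HA1 & _) (HB1 & _); extensionality i; extensionality j.
    rewrite (mmul_diag N A B i j HA1), (mmul_diag N B A i j HB1); destruct (Fin.eq_dec i j) as [->|Hij]; [ring|].
    rewrite (HA1 i j Hij), (HB1 i j Hij); ring.
Qed.

Lemma fin_cat (P : C -> Prop) p q (a : Fin.t p -> C) (b : Fin.t q -> C) :
  (forall i, P (a i)) -> (forall j, P (b j)) ->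
  exists d : Fin.t (p + q) -> C, (forall k, P (d k)) /\
    (forall i, d (Fin.L q i) = a i) /\ (forall j, d (Fin.R p j) = b j).
Proof.
  intros Ha Hb; induction p as [|p IH].
  - exists b; repeat split; trivial; intros i; apply (Fin.case0 (fun i => _) i).
  - destruct (IH (fun i => a (Fin.FS i))) as (d & H0 & H1 & H2); [auto|].
    exists (fun k => Fin.caseS' k (fun _ => C) (a Fin.F1) d); split; [|split; [|exact H2]].
    + apply fin_case; [apply Ha | exact H0].
    + apply fin_case; [reflexivity | exact H1].
Qed.

Lemma Cnorm_cexp z : Cnorm (cexp z) = exp (fst z).
Proof.
  unfold Cnorm, cexp; simpl.
  replace (exp (fst z) * cos (snd z) * (exp (fst z) * cos (snd z))
           + exp (fst z) * sin (snd z) * (exp (fst z) * sin (snd z)))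
    with (exp (fst z) * exp (fst z) * (Rsqr (sin (snd z)) + Rsqr (cos (snd z))))
    by (unfold Rsqr; ring).
  rewrite sin2_cos2, Rmult_1_r; apply sqrt_square; left; apply exp_pos.
Qed.

Lemma Cnorm_reverse_triangle z w : Rabs (Cnorm z - Cnorm w) <= Cnorm (z - w)%cx.
Proof.
  pose proof (Cnorm_triangle (z - w)%cx w) as H1.
  replace (z - w + w)%cx with z in H1 by ring.
  pose proof (Cnorm_triangle (- (z - w))%cx z) as H2.
  replace (- (z - w) + z)%cx with w in H2 by ring.
  rewrite Cnorm_opp in H2; apply Rabs_le; lra.
Qed.

(** The continuous homomorphism from the multiplicative group of [C] onto the additive group of
    reals, with the real exponential as a section. *)
Definition lognorm (z : C) : R := ln (Cnorm z).

Lemma lognorm_mul z w : z <> C0 -> w <> C0 -> lognorm (z * w)%cx = lognorm z + lognorm w.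
Proof. intros; unfold lognorm; rewrite Cnorm_mul; apply ln_mult; apply Cnorm_pos; trivial. Qed.

Lemma lognorm_cexp z : lognorm (cexp z) = fst z.
Proof. unfold lognorm; rewrite Cnorm_cexp; apply ln_exp. Qed.

Lemma lognorm_entry_cont N (G : mat N -> Prop) (A : mat N) i :
  A i i <> C0 -> rcont_at (fun d B => G B /\ mdist B A d) A (fun B => lognorm (B i i)).
Proof.
  intros HA; apply (rcont_comp _ _ _ (fun B => Cnorm (B i i)) ln).
  - intros eps He; exists eps; split; [trivial|]; intros B [_ HB].
    eapply Rle_lt_trans; [apply Cnorm_reverse_triangle | apply HB].
  - apply derivable_continuous_pt; exists (/ Cnorm (A i i)).
    apply derivable_pt_lim_ln, Cnorm_pos; trivial.
Qed.

(** Roots of unity are isolated, and finitely many entries admit a common radius. This makes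
    discrete exponents read off from such entries locally constant. *)
Lemma entries_locally_constant N m U q (u : Fin.t q -> Fin.t N) A :
  (0 < m)%nat -> (forall i, U (u i)) -> diag_group N m U A ->
  exists d, d > 0 /\ forall B, diag_group N m U B -> mdist B A d ->
    forall i, B (u i) (u i) = A (u i) (u i).
Proof.
  intros Hm HU HA; induction q as [|q IH].
  - exists 1; split; [lra|]; intros B _ _ i; apply (Fin.case0 (fun i => _) i).
  - destruct (IH (fun i => u (Fin.FS i))) as (d & Hd & Hd'); [auto|].
    destruct (unity_root_isolated m Hm (A (u Fin.F1) (u Fin.F1))) as (d2 & Hd2 & Hd2');
      [apply HA, HU|].
    exists (Rmin d d2); split; [apply Rmin_pos; trivial|]; intros B HB HBA.
    apply fin_case.
    + apply Hd2'; [apply HB, HU|]; eapply Rlt_le_trans; [apply HBA | apply Rmin_r].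
    + apply Hd'; trivial; intros i j; eapply Rlt_le_trans; [apply HBA | apply Rmin_l].
Qed.

(** * Covering the image of the lattice and of the real parameters by a diagonal group *)

Theorem theorem2p6 (n p q : nat)
  (rho : (Fin.t p -> Z) -> (Fin.t q -> R) -> series n -> series n) :
  IsLieHomZR n p q rho ->
  exists (N : nat) (G : mat N -> Prop) (rhostar : mat N -> series n -> series n),
    AbelianLinAlgGroup N G /\ IsLieHomAlg n N G rhostar /\
    (forall k t, exists A, G A /\ rhostar A = rho k t).
Proof.
  intros (Hrho & Hadd & Hcont).
  assert (Hz : radd (fun _ : Fin.t q => 0) (fun _ => 0) = fun _ => 0)
    by (extensionality i; unfold radd; ring).
  destruct (multiflow_of_lattice n p (fun k => rho k (fun _ => 0)))
    as (m & Phi & Hm & HPhi & HPhig & HPhic & HPhih & HPhik).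
  { intros; apply Hrho. }
  { intros k k' f; rewrite <- Hadd, Hz; trivial. }
  pose proof (INR_m_neq_0 m Hm) as Hm0.
  assert (Hcomm : forall k t s f, rho k t (Phi s f) = Phi s (rho k t f)).
  { intros k t s f; apply HPhih; [apply Hrho|]; intros k' g; rewrite <- !Hadd.
    f_equal; extensionality i; unfold zadd, radd; ring. }
  (* Shifting the discrete coordinate by [m c] is absorbed by the flow. *)
  assert (Hcarry : forall c k t s f,
    Phi (fun i => s i - IZR (c i)) (rho (fun i => (k i + Z.of_nat m * c i)%Z) t f)
    = Phi s (rho k t f)).
  { intros c k t s f.
    replace (fun i => s i - IZR (c i)) with (radd s (fun i => IZR (- c i)))
      by (extensionality i; unfold radd; rewrite opp_IZR; ring).
    rewrite HPhig, (HPhik (fun i => - c i)%Z), <- Hadd; f_equal; f_equal.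
    - extensionality i; unfold zadd; ring.
    - extensionality i; unfold radd; ring. }
  (* A chosen exponent for each root of unity. It is additive only modulo [m]; the carries [c] below
     record the defect. *)
  assert (He : exists e : C -> Z, forall z, Cpow z m = C1 -> z = unity_root m (e z)).
  { apply (choice (fun z k => Cpow z m = C1 -> z = unity_root m k)); intros z.
    destruct (classic (Cpow z m = C1)) as [E|E]; [|exists 0%Z; tauto].
    destruct (unity_root_surj m Hm z E) as [k Hk]; exists k; auto. }
  destruct He as [e He].
  (* Three diagonal blocks: flow times of the lattice generators, roots of unity for their residues
     modulo [m], and the original real parameters. *)
  set (N := (p + (p + q))%nat).
  set (u1 := fun i : Fin.t p => Fin.L (p + q) i : Fin.t N).
  set (u2 := fun i : Fin.t p => Fin.R p (Fin.L q i) : Fin.t N).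
  set (u3 := fun j : Fin.t q => Fin.R p (Fin.R p j) : Fin.t N).
  set (U := fun j => exists i, j = u2 i).
  set (ev := fun (A : mat N) i => e (A (u2 i) (u2 i))).
  set (sv := fun (A : mat N) i => lognorm (A (u1 i) (u1 i))).
  set (tv := fun (A : mat N) j => lognorm (A (u3 j) (u3 j))).
  set (G := diag_group N m U).
  assert (HU : forall i, U (u2 i)) by (intros i; exists i; trivial).
  exists N, G, (fun A f => Phi (fun i => sv A i - IZR (ev A i) / INR m) (rho (ev A) (tv A) f)).
  split; [apply diag_group_algebraic|]; split; [split; [|split]|].
  - intros A _; apply (aut_comp n (Phi _)); [apply HPhi | apply Hrho].
  - intros A B f HA HB.
    assert (HAB : forall i, mmul A B i i = (A i i * B i i)%cx)
      by (intros i; apply mmul_diag, HA).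
    assert (Hc : forall i, exists c, ev (mmul A B) i = (ev A i + ev B i + Z.of_nat m * c)%Z).
    { intros i; apply unity_root_inj; trivial.
      rewrite unity_root_add by trivial; unfold ev.
      rewrite <- (He (A (u2 i) (u2 i))), <- (He (B (u2 i) (u2 i))), <- HAB by (apply HA || apply HB; trivial).
      symmetry; apply He; rewrite HAB, Cpow_mul.
      destruct HA as (_ & _ & HA3), HB as (_ & _ & HB3); rewrite HA3, HB3 by trivial; ring. }
    destruct (choice _ Hc) as [c Hc'].
    replace (ev (mmul A B)) with (fun i => zadd (ev A) (ev B) i + Z.of_nat m * c i)%Z
      by (extensionality i; symmetry; apply Hc').
    replace (tv (mmul A B)) with (radd (tv A) (tv B)).
    2: { extensionality j; unfold tv, radd; rewrite HAB, lognorm_mul; trivial; [apply HA | apply HB]. }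
    replace (fun i => sv (mmul A B) i - IZR (zadd (ev A) (ev B) i + Z.of_nat m * c i) / INR m)
      with (fun i => radd (fun i => sv A i - IZR (ev A i) / INR m)
                          (fun i => sv B i - IZR (ev B i) / INR m) i - IZR (c i)).
    2: { extensionality i; unfold sv, radd, zadd; rewrite HAB, lognorm_mul by (apply HA || apply HB).
         rewrite !plus_IZR, mult_IZR, <- INR_IZR_INZ; field; trivial. }
    rewrite Hcarry, HPhig, Hadd, Hcomm; trivial.
  - intros a b A eps HA Heps.
    set (near := fun d B => G B /\ mdist B A d).
    assert (Hn : antitone near).
    { intros d d' B Hd [HB1 HB2]; split; [trivial|]; intros i j; specialize (HB2 i j); lra. }
    pose proof (cont_at_alg _ near A Hn) as HV.
    (* The discrete exponents are frozen at their values for [A]; near [A] they agree with those of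
       [B], so only the real parameters vary. *)
    set (x := fun B i => sv B i - IZR (ev A i) / INR m).
    assert (HF : cont_at near A (fun B => Phi (x B) (rho (ev A) (tv B) (mono b)) a)).
    { apply (aut_family_closed n _ _ (fun B => Phi (x B)) (deg a) HV (fun B => HPhi (x B)));
        [| lia |].
      - intros i c _; apply (cont_comp_V _ near A p x (fun s => Phi s (X i) c) Hn); [|apply HPhic].
        intros j; unfold x.
        apply (rcont_comp _ near A (fun B => sv B j) (fun y => y - IZR (ev A j) / INR m)); [|reg].
        apply lognorm_entry_cont, HA.
      - intros c; apply (cont_comp_V _ near A q tv (fun t => rho (ev A) t (mono b) c) Hn).
        + intros j; apply lognorm_entry_cont, HA.
        + intros eps' He'; apply Hcont; trivial. }
    destruct (HF eps Heps) as (d & Hd & Hd').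
    destruct (entries_locally_constant N m U p u2 A Hm HU HA) as (d2 & Hd2 & Hd2').
    exists (Rmin d d2); split; [apply Rmin_pos; trivial|]; intros B HB HBA.
    assert (Ee : ev B = ev A).
    { extensionality i; unfold ev; rewrite Hd2'; trivial.
      intros k l; eapply Rlt_le_trans; [apply HBA | apply Rmin_r]. }
    unfold jcoef; rewrite Ee; apply (Hd' B); split; [trivial|].
    intros k l; eapply Rlt_le_trans; [apply HBA | apply Rmin_l].
  - intros k t.
    (* The preimage of [rho k t] has blocks [exp(k_i / m)], the root of unity of index [k_i], and
       [exp(t_j)]. The time [k_i / m] cancels the correction [- e_i / m] up to the integer carry. *)
    destruct (fin_cat (fun z => z <> C0) p q (fun i => unity_root m (k i)) (fun j => cexp (t j, 0)))
      as (d' & Hd0' & Hd1 & Hd2); [intros; apply cexp_neq_0 | intros; apply cexp_neq_0 |].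
    destruct (fin_cat (fun z => z <> C0) p (p + q) (fun i => cexp (IZR (k i) / INR m, 0)) d')
      as (d & Hd0 & Hd3 & Hd4); [intros; apply cexp_neq_0 | trivial |].
    set (A := fun i j => if Fin.eq_dec i j then d i else C0).
    assert (HA : forall i, A i i = d i).
    { intros i; unfold A; destruct Fin.eq_dec; congruence. }
    exists A; split.
    + repeat split.
      * intros i j Hij; unfold A; destruct Fin.eq_dec; congruence.
      * intros i; rewrite HA; trivial.
      * intros j [i ->]; rewrite HA; unfold u2; rewrite Hd4, Hd1; apply unity_root_pow; trivial.
    + assert (Hc : forall i, exists c, ev A i = (k i + Z.of_nat m * c)%Z).
      { intros i; apply unity_root_inj; trivial; symmetry; unfold ev, u2.
        rewrite HA, Hd4, Hd1; apply He, unity_root_pow; trivial. }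
      destruct (choice _ Hc) as [c Hc']; extensionality f.
      replace (ev A) with (fun i => k i + Z.of_nat m * c i)%Z
        by (extensionality i; symmetry; apply Hc').
      replace (tv A) with t
        by (extensionality j; unfold tv, u3; rewrite HA, Hd4, Hd2, lognorm_cexp; trivial).
      replace (fun i => sv A i - IZR (k i + Z.of_nat m * c i) / INR m)
        with (fun i : Fin.t p => 0 - IZR (c i)).
      2: { extensionality i; unfold sv, u1; rewrite HA, Hd3, lognorm_cexp; simpl.
           rewrite plus_IZR, mult_IZR, <- INR_IZR_INZ; field; trivial. }
      rewrite (Hcarry c k t (fun _ => 0)).
      (* The remaining flow at time zero is [rho] at the neutral element, which the homomorphism law
         absorbs. *)
      rewrite (HPhik (fun _ => 0%Z)), <- Hadd; f_equal.
      * extensionality i; unfold zadd; ring.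
      * extensionality i; unfold radd; ring.
Qed.
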